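(* Let $\mathfrak{T}$ be any task and $\gamma > 0$. Then, for any sufficiently small $\varepsilon, \delta > 0$ and any $m \in \mathbb{N}$, there exist $\varepsilon' = \frac{\varepsilon^2}{\log(1/\delta)\sqrt{m\log(m/\delta)}}$ and $\delta' = \Theta\left(\delta\cdot\frac{\varepsilon}{m\log(1/\delta)}\right)$ such that \[ n^{\mathfrak{T}}_m(\varepsilon,\delta;\gamma - o(1)) \le \tilde{O}\left(\frac{\log(1/\delta)}{\varepsilon} + \frac{1}{m}\cdot n^{\mathfrak{T}}_1(\varepsilon',\delta';\gamma)\right). \]
   Context: Let $\mathcal{Z}$ be a sample domain and $\mathcal{O}$ a finite output set. In the user-level setting there are $n$ users, each holding $m$ examples; the input is $\mathbf{x}\in\mathcal{Z}^{nm}$ with $\mathbf{x}_i=(x_{i,1},\dots,x_{i,m})$ user $i$'s data. Two inputs are user-level neighbors if they differ only in the data of a single user. A randomized algorithm $\mathbf{A}$ is $(\varepsilon,\delta)$-user-level DP if for all user-level neighbors $\mathbf{x},\mathbf{x}'$ and all $S\subseteq\mathcal{O}$, $\Pr[\mathbf{A}(\mathbf{x})\in S]\le e^{\varepsilon}\Pr[\mathbf{A}(\mathbf{x}')\in S]+\delta$; when $m=1$ it is called item-level DP. A task $\mathfrak{T}$ specifies, for every valid distribution $\mathcal{D}$ over $\mathcal{Z}$, a set $\Psi_{\mathfrak{T}}(\mathcal{D})\subseteq\mathcal{O}$ of correct answers; an algorithm on $nm$ samples is $\gamma$-useful if $\Pr_{\mathbf{x}\sim\mathcal{D}^{nm}}[\mathbf{A}(\mathbf{x})\in\Psi_{\mathfrak{T}}(\mathcal{D})]\ge\gamma$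 for every valid $\mathcal{D}$. $n^{\mathfrak{T}}_m(\varepsilon,\delta;\gamma)$ denotes the smallest number $n$ of users such that some $(\varepsilon,\delta)$-user-level DP algorithm with $n$ users of $m$ examples each is $\gamma$-useful for $\mathfrak{T}$ (so $n^{\mathfrak{T}}_1$ is the item-level sample complexity). $\tilde{O}$ hides polylogarithmic factors. ''Sufficiently small'' means at most some implicit absolute constant. *)

(* Defs.v *)
From HB Require Import structures.
From mathcomp Require Import all_boot all_order all_algebra.
From mathcomp Require Import all_classical all_reals all_analysis.

Set Implicit Arguments.
Unset Strict Implicit.
Unset Printing Implicit Defensive.

Import Order.TTheory GRing.Theory Num.Theory.
Import numFieldNormedType.Exports.

Local Open Scope classical_set_scope.
Local Open Scope ring_scope.

Section product_distribution.
Context (d : measure_display) (T : measurableType d) (R : realType).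

Definition tcons (n : nat) (z : T * n.-tuple T) : n.+1.-tuple T :=
  [the n.+1.-tuple T of z.1 :: z.2].

Lemma measurable_tcons (n : nat) : measurable_fun setT (@tcons n).
Proof. exact: measurable_cons measurable_fst measurable_snd. Qed.

HB.instance Definition _ (n : nat) :=
  isMeasurableFun.Build _ _ _ _ (@tcons n) (@measurable_tcons n).

(* The n-fold product D^n, as a probability on n.-tuple T. *)
Fixpoint iid (D : probability T R) (n : nat) : probability (n.-tuple T) R :=
  match n with
  | 0 => dirac [tuple]
  | n'.+1 => distribution (D \x iid D n')%E (@tcons n')
  end.

(* Boxes generate the sigma-algebra of n.-tuple T, so this determines iid D n. *)
Lemma iid_box (D : probability T R) (n : nat) (B : 'I_n -> set T) :
  (forall i, measurable (B i)) ->
  iid D n [set x | forall i, B i (tnth x i)] = (\prod_(i < n) D (B i))%E.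
Proof.
elim: n B => [|n IH] B mB.
  rewrite big_ord0 /= diracE mem_set //= => -[].
  by [].
rewrite big_ord_recl -(IH (fun i => B (lift ord0 i))) //.
rewrite [LHS]/= /distribution /pushforward.
rewrite (_ : _ @^-1` _ =
  B ord0 `*` [set x | forall i, B (lift ord0 i) (tnth x i)]).
  apply: product_measure1E => //.
  rewrite (_ : [set x | _] = \big[setI/setT]_(i < n)
    ((fun x => tnth x i) @^-1` B (lift ord0 i))).
    apply: bigsetI_measurable => i _; rewrite -[X in measurable X]setTI.
    exact: measurable_tnth.
  apply/seteqP; split => x.
    by move=> /= Bx; rewrite -bigcap_seq => i _; exact: Bx.
  by rewrite -bigcap_seq => /= Bx i; apply: Bx => /=; rewrite mem_index_enum.
apply/seteqP; split => -[z x] /=.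
  by move=> Bx; split=> [|i]; [exact: (Bx ord0) | have := Bx (lift ord0 i); rewrite tnthS].
by move=> [Bz Bx] i; case: (unliftP ord0 i) => [j|] -> //; rewrite tnthS.
Qed.

End product_distribution.

(* x : n.-tuple (m.-tuple Z) is an element of Z^{nm}; tnth x i is the data of
   user i. Accordingly D^{nm} is iid (iid D m) n. *)

Definition user_neighbors (n m : nat) (Z : Type)
    (x x' : n.-tuple (m.-tuple Z)) : Prop :=
  exists i : 'I_n, forall j : 'I_n, j != i -> tnth x j = tnth x' j.

(* As O is finite, a randomized algorithm is a Markov kernel given by its mass
   function: prob x o is Pr[A(x) = o]. *)
Record rand_alg (R : realType) (d : measure_display) (Z : measurableType d)
    (O : finType) (n m : nat) := RandAlg {
  prob :> n.-tuple (m.-tuple Z) -> O -> R ;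
  prob_ge0 : forall x o, 0 <= prob x o ;
  prob_sum1 : forall x, \sum_o prob x o = 1 ;
  prob_measurable : forall o, measurable_fun setT (fun x => prob x o) }.

Definition prob_in (R : realType) (d : measure_display) (Z : measurableType d)
    (O : finType) (n m : nat) (A : rand_alg R Z O n m)
    (x : n.-tuple (m.-tuple Z)) (S : {set O}) : R :=
  \sum_(o in S) A x o.

Definition user_level_DP (R : realType) (d : measure_display)
    (Z : measurableType d) (O : finType) (n m : nat)
    (eps delta : R) (A : rand_alg R Z O n m) : Prop :=
  forall x x' : n.-tuple (m.-tuple Z), user_neighbors x x' ->
  forall S : {set O}, prob_in A x S <= expR eps * prob_in A x' S + delta.

(* The values of correct outside valid are irrelevant. *)
Record task (R : realType) (d : measure_display) (Z : measurableType d)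
    (O : finType) := Task {
  valid : set (probability Z R) ;
  correct : probability Z R -> {set O} }.

Definition useful (R : realType) (d : measure_display) (Z : measurableType d)
    (O : finType) (n m : nat) (T : task R Z O) (gamma : R)
    (A : rand_alg R Z O n m) : Prop :=
  forall D : probability Z R, valid T D ->
  (gamma%:E <= \int[iid (iid D m) n]_x (prob_in A x (correct T D))%:E)%E.

Definition achievable (R : realType) (d : measure_display)
    (Z : measurableType d) (O : finType) (T : task R Z O) (m : nat)
    (eps delta gamma : R) (n : nat) : Prop :=
  exists A : rand_alg R Z O n m, user_level_DP eps delta A /\ useful T gamma A.

(* The smallest achievable n, and +oo if there is none. *)
Definition sample_complexity (R : realType) (d : measure_display)
    (Z : measurableType d) (O : finType) (T : task R Z O) (m : nat)
    (eps delta gamma : R) : \bar R :=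
  ereal_inf [set n%:R%:E | n in achievable T m eps delta gamma].

(* O~(x) is rendered as C * x * log(x)^k, with C and k absolute constants. *)
Definition polylog_bound (R : realType) (C : R) (k : nat) (x : \bar R) :
    \bar R :=
  (C%:E * x * lne x ^+ k)%E.

Definition item_eps (R : realType) (eps delta : R) (m : nat) : R :=
  eps ^+ 2 / (ln delta^-1 * Num.sqrt (m%:R * ln (m%:R / delta))).

(* delta' = Theta(item_delta_scale eps delta m). *)
Definition item_delta_scale (R : realType) (eps delta : R) (m : nat) : R :=
  delta * (eps / (m%:R * ln delta^-1)).

(* The argument of O~: log(1/delta)/eps + n_1(eps', delta'; gamma)/m. *)
Definition user_scale (R : realType) (d : measure_display)
    (Z : measurableType d) (O : finType) (T : task R Z O) (m : nat)
    (eps delta eps' delta' gamma : R) : \bar R :=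
  ((ln delta^-1 / eps)%:E
   + (m%:R^-1)%:E * sample_complexity T 1 eps' delta' gamma)%E.

(* Main.v *)
(** Let [A] be an item-level private algorithm on [N] samples. Running [A] on a random
    injective selection of the examples of a set [U] of users gives a mechanism [P_U] which
    reads only [U] and whose item-level privacy is amplified by the sampling rate; this
    absorbs all logarithmic factors.

    Call a set [S] of users stable for the input [x] if the output distributions [P_U x],
    for [U] of a fixed size and disjoint from [S], are pairwise indistinguishable.
    Stability of [S] depends only on the data outside [S], so changing one user changes
    the least size of a stable set by at most one. The user-level algorithm outputs a
    sample of [P_U x], with [U] disjoint from a stable set of size [kappa], with a
    probability that decays smoothly with this least size; for two neighbouring inputs, a
    [V] avoiding both stable sets and the changed user satisfies
    [P_U x ~ P_V x = P_V x' ~ P_U' x'].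

    For utility one needs the empty set to be stable with high probability on i.i.d. data.
    For fixed [U] and [U'], exchangeability allows one to swap the examples of [U \ U'] and
    [U' \ U] according to a uniform point [v] of a cube, and [P_U x ~ P_U' x] becomes
    [Q v ~ Q (~ v)] for a family [Q] of distributions which is private along the edges of
    the cube. An induction on the dimension bounds the average hockey-stick divergence of
    [Q v] and [Q (~ v)], so half of the cube is good; by concentration of the Hamming
    distance almost every [v] is close to a good point, and group privacy transfers the
    property to [v]. The failure probability beats the union bound over [U] and [U']. *)
Require Import Defs.
From mathcomp Require Import all_boot all_order all_algebra.
From mathcomp Require Import all_classical all_reals all_analysis.
From mathcomp Require Import perm measurable_realfun.
From mathcomp Require Import ring lra zify.
Set Implicit Arguments.
Unset Strict Implicit.
Unset Printing Implicit Defensive.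
Import Order.TTheory GRing.Theory Num.Theory.
Import numFieldNormedType.Exports.
Local Open Scope classical_set_scope.
Local Open Scope ring_scope.

(** * Averages over the cube *)

Section cube_average.
Context (R : realType).
Implicit Types (f g h k : seq bool -> R) (x y : R).

Definition pos x : R := Num.max x 0.

Lemma pos_ge0 x : 0 <= pos x.
Proof. by rewrite le_max lexx orbT. Qed.

Lemma pos_ge x : x <= pos x.
Proof. by rewrite le_max lexx. Qed.

Lemma pos_le x y : (pos x <= y) = (x <= y) && (0 <= y).
Proof. by rewrite ge_max. Qed.

Lemma pos_subadd x y : pos (x + y) <= pos x + pos y.
Proof. by rewrite pos_le lerD ?pos_ge ?addr_ge0 ?pos_ge0. Qed.

Lemma pos_half x y : pos ((x + y) / 2) <= (pos x + pos y) / 2.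
Proof.
rewrite pos_le; have := pos_ge x; have := pos_ge y.
have := pos_ge0 x; have := pos_ge0 y; lra.
Qed.

(** The average over the cube of dimension [M] is halved along the first coordinate, since the
    bounds on the cube are proved by induction on the dimension. *)
Fixpoint avg (M : nat) f : R :=
  match M with
  | 0 => f [::]
  | M'.+1 => (avg M' (fun v => f (true :: v)) + avg M' (fun v => f (false :: v))) / 2
  end.

Lemma avg_le M f g :
  (forall v, size v = M -> f v <= g v) -> avg M f <= avg M g.
Proof.
elim: M f g => [|M IH] f g fg /=; first exact: fg.
rewrite ler_pM2r ?invr_gt0 //; apply: lerD; apply: IH => v sv; apply: fg => /=; by rewrite sv.
Qed.

Lemma eq_avg M f g : (forall v, size v = M -> f v = g v) -> avg M f = avg M g.
Proof.
by move=> fg; apply/eqP; rewrite eq_le !avg_le // => v /fg ->.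
Qed.

Lemma avgD M f g : avg M (fun v => f v + g v) = avg M f + avg M g.
Proof. elim: M f g => [//|M IH] f g /=; rewrite !IH; lra. Qed.

Lemma avgZ M x f : avg M (fun v => x * f v) = x * avg M f.
Proof. elim: M f => [//|M IH] f /=; rewrite !IH; lra. Qed.

Lemma avg_cst M x : avg M (fun _ => x) = x.
Proof. elim: M => [//|M IH] /=; rewrite !IH; lra. Qed.

Lemma avg_ge0 M f : (forall v, 0 <= f v) -> 0 <= avg M f.
Proof. by move=> f0; rewrite -(avg_cst M 0); exact: avg_le. Qed.

Lemma avg_sum (I : finType) M (F : I -> seq bool -> R) :
  avg M (fun v => \sum_i F i v) = \sum_i avg M (F i).
Proof.
elim: M F => [//|M IH] F /=.
by rewrite !IH -big_split /= mulr_suml.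
Qed.

Lemma pos_avg M f : pos (avg M f) <= avg M (fun v => pos (f v)).
Proof.
elim: M f => [//|M IH] f /=; apply: (le_trans (pos_half _ _)).
by rewrite ler_pM2r ?invr_gt0 // lerD.
Qed.

End cube_average.

(** * Elementary exponential inequalities *)

Section exponential_bounds.
Context (R : realType).
Implicit Types x y : R.

Lemma inv1B_le_expR x : `|x| <= 2^-1 -> (1 - x)^-1 <= expR (x + 2 * x ^+ 2).
Proof.
rewrite ler_norml => /andP[xl xu].
rewrite -[leLHS]mul1r ler_pdivrMr; last lra.
apply: (@le_trans _ _ ((1 + (x + 2 * x ^+ 2)) * (1 - x))).
  have -> : (1 + (x + 2 * x ^+ 2)) * (1 - x) = 1 + x ^+ 2 * (1 - 2 * x) by ring.
  have : 0 <= x ^+ 2 * (1 - 2 * x) by rewrite mulr_ge0 ?sqr_ge0 //; lra.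
  lra.
by rewrite ler_wpM2r ?expR_ge1Dx //; lra.
Qed.

Lemma expR_le_inv1B x : x < 1 -> expR x <= (1 - x)^-1.
Proof.
move=> x1; rewrite -[leLHS]invrK -expRN lef_pV2 ?posrE ?expR_gt0 //; last lra.
exact: expR_ge1Dx.
Qed.

Lemma expR_le1D2 x : 0 <= x <= 2^-1 -> expR x <= 1 + 2 * x.
Proof.
move=> /andP[x0 x1]; apply: (le_trans (expR_le_inv1B _)); first lra.
rewrite -[leLHS]mul1r ler_pdivrMr; last lra.
have -> : (1 + 2 * x) * (1 - x) = 1 + x * (1 - 2 * x) by ring.
have : 0 <= x * (1 - 2 * x) by rewrite mulr_ge0 //; lra.
lra.
Qed.

(** Up to 1/2 one has [expR y <= 1 + y + 2 * y ^+ 2] for [y = x] and [y = - x], and the linear terms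
    cancel; beyond 1/2 already [x <= 2 * x ^+ 2]. *)
Lemma cosh_le x : expR x + expR (- x) <= 2 * expR (2 * x ^+ 2).
Proof.
wlog x0 : x / 0 <= x.
  move=> wl; have [|/ltW x0] := leP 0 x; first exact: wl.
  by have := wl (- x); rewrite opprK sqrrN addrC; apply; rewrite oppr_ge0.
have [xh|xh] := leP x 2^-1.
  apply: (@le_trans _ _ (2 * (1 + 2 * x ^+ 2))); last first.
    by rewrite ler_pM2l // expR_ge1Dx.
  have e y : `|y| <= 2^-1 -> expR y <= 1 + y + 2 * y ^+ 2.
    rewrite ler_norml => /andP[yl yu].
    apply: (le_trans (expR_le_inv1B _)); first lra.
    rewrite -[leLHS]mul1r ler_pdivrMr; last lra.
    have -> : (1 + y + 2 * y ^+ 2) * (1 - y) = 1 + y ^+ 2 * (1 - 2 * y) by ring.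
    have : 0 <= y ^+ 2 * (1 - 2 * y) by rewrite mulr_ge0 ?sqr_ge0 //; lra.
    lra.
  have := e x; have := e (- x); rewrite normrN sqrrN ger0_norm // => /(_ xh) + /(_ xh).
  lra.
have xx : x <= 2 * x ^+ 2 by rewrite expr2; nra.
have : expR x <= expR (2 * x ^+ 2) by rewrite ler_expR.
have : expR (- x) <= expR (2 * x ^+ 2) by rewrite ler_expR; lra.
lra.
Qed.

End exponential_bounds.

(** * Average divergence between antipodal points *)

Section cube_expectation.
Context (R : realType).
Implicit Types (h k : seq bool -> R).
Variables (eta : R) (lam : nat).
Hypothesis eta_bnd : 0 <= eta <= 2^-1.

Let E := expR eta.
Let gain := expR (2 * lam%:R * eta ^+ 2 + 2 * ((2 * lam + 1)%:R * eta) ^+ 2).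

(** Here [s] and [t] stand for the relative imbalances of two pairs of masses. The exponents linear
    in them have opposite signs in the two summands, so by [cosh_le] only terms of second order in
    [eta] survive. *)
Lemma gain_bound (s t : R) : `|s| <= eta -> `|t| <= eta ->
  (1 + s) ^+ lam.+1 * ((1 - t)^-1) ^+ lam +
  (1 - s) ^+ lam.+1 * ((1 + t)^-1) ^+ lam <= 2 * gain.
Proof.
move=> se te; case/andP: eta_bnd => e0 eh.
have term (a b : R) : `|a| <= eta -> `|b| <= eta ->
    (1 + a) ^+ lam.+1 * ((1 - b)^-1) ^+ lam <=
    expR (2 * lam%:R * eta ^+ 2) * expR (lam.+1%:R * a + lam%:R * b).
  move=> ae be.
  have b2 : b ^+ 2 <= eta ^+ 2 by rewrite -(real_normK (num_real b)) ler_sqr ?nnegrE ?normr_ge0.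
  rewrite -expRD.
  apply: (@le_trans _ _ (expR (lam.+1%:R * a) * expR (lam%:R * (b + 2 * b ^+ 2)))).
    rewrite !expRM_natl; apply: ler_pM.
    - by apply: exprn_ge0; move: ae; rewrite ler_norml => /andP[]; lra.
    - by apply: exprn_ge0; rewrite invr_ge0; move: be; rewrite ler_norml => /andP[]; lra.
    - rewrite ler_pXn2r ?nnegrE ?expR_ge0 ?expR_ge1Dx //.
      by move: ae; rewrite ler_norml => /andP[]; lra.
    - case: (lam) => [|l]; first by rewrite !expr0.
      rewrite ler_pXn2r ?nnegrE ?expR_ge0 ?inv1B_le_expR ?(le_trans be) //.
      by rewrite invr_ge0; move: be; rewrite ler_norml => /andP[]; lra.
  rewrite -expRD ler_expR.
  have : lam%:R * (2 * b ^+ 2) <= lam%:R * (2 * eta ^+ 2).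
    by rewrite ler_wpM2l // ler_pM2l.
  lra.
have t1 := term s t se te.
have t2 := term (- s) (- t); rewrite !normrN opprK in t2.
have {}t2 := t2 se te.
apply: (le_trans (lerD t1 t2)); rewrite -mulrDr /gain [in leRHS]expRD.
rewrite [leRHS]mulrCA ler_pM2l ?expR_gt0 //.
set y := lam.+1%:R * s + lam%:R * t.
have -> : lam.+1%:R * - s + lam%:R * - t = - y by rewrite /y; ring.
apply: (le_trans (cosh_le y)); rewrite ler_pM2l // ler_expR ler_pM2l //.
rewrite -(real_normK (num_real y)) ler_sqr ?nnegrE ?normr_ge0 ?mulr_ge0 //.
apply: (le_trans (ler_normD _ _)); rewrite !normrM !normr_nat.
have : lam.+1%:R * `|s| <= lam.+1%:R * eta by rewrite ler_wpM2l.
have : lam%:R * `|t| <= lam%:R * eta by rewrite ler_wpM2l.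
rewrite natrD natrM -addn1 natrD; lra.
Qed.

(** Since [E * (1 - eta) <= 1], the bound [x <= E * y] gives [x * (1 - eta) <= y], that is
    [x - y <= eta * x]. *)
Lemma ratio_deviation (a0 a1 : R) : 0 < a0 -> 0 < a1 -> a0 <= E * a1 -> a1 <= E * a0 ->
  `|(a0 - a1) / (a0 + a1)| <= eta.
Proof.
move=> a00 a10 l0 l1; case/andP: eta_bnd => e0 eh.
have Eh : E * (1 - eta) <= 1.
  rewrite -ler_pdivlMr; last lra.
  by rewrite mul1r expR_le_inv1B //; lra.
have half x y : 0 < x -> 0 < y -> x <= E * y -> x - y <= eta * (x + y).
  move=> x0 y0 xy.
  have : x * (1 - eta) <= E * y * (1 - eta) by rewrite ler_wpM2r //; lra.
  have : E * (1 - eta) * y <= 1 * y by rewrite ler_wpM2r // ltW.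
  have : 0 <= eta * y by rewrite mulr_ge0 // ltW.
  lra.
rewrite normrM normfV (gtr0_norm (addr_gt0 a00 a10)) ler_pdivrMr ?addr_gt0 //.
rewrite ler_norml half // andbT lerNl opprB (addrC a0) half //.
Qed.

Definition excess (A0 A1 : R) := pos (A0 - E * A1) + pos (A1 - E * A0).

Let E1 : 1 <= E.
Proof. by case/andP: eta_bnd => e0 _; rewrite /E -expR0 ler_expR. Qed.

(** Each mass is cut down to [E] times the other. As [E >= 1], at most one of the two cuts is
    active, and the removed mass is the excess. *)
Lemma clip_props (A0 A1 : R) : 0 <= A0 -> 0 <= A1 ->
  exists a0 a1 : R, [/\ 0 <= a0 <= A0, 0 <= a1 <= A1,
    a0 <= E * a1, a1 <= E * a0 & excess A0 A1 = (A0 + A1) - (a0 + a1)].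
Proof.
move=> A00 A10; exists (Num.min A0 (E * A1)), (Num.min A1 (E * A0)).
have EA0 : A0 <= E * A0 by rewrite ler_peMl.
have EA1 : A1 <= E * A1 by rewrite ler_peMl.
have EE0 : E * A0 <= E * (E * A0) by rewrite ler_pM2l ?expR_gt0.
have EE1 : E * A1 <= E * (E * A1) by rewrite ler_pM2l ?expR_gt0.
have E00 : 0 <= E * A0 by lra.
have E10 : 0 <= E * A1 by lra.
rewrite /excess /pos !minEle !maxEle !subr_le0.
have [le0|lt0] := leP A0 (E * A1); have [le1|lt1] := leP A1 (E * A0); split; lra.
Qed.

(* One coordinate: after moving the mass outside the ratio band [e^-eta, e^eta] to
   the error term, the [lam]-th moment of the likelihood ratio grows by [gain]. *)
Lemma clip_step (A0 A1 B0 B1 rho c : R) :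
  0 <= A0 -> 0 <= A1 -> 0 <= B0 -> 0 <= B1 -> 0 <= rho -> 0 <= c <= 1 ->
  rho * (A0 + A1) <= c * (B0 + B1) ->
  exists rho0 rho1 c0 c1 : R,
    [/\ 0 <= rho0 <= rho, 0 <= rho1 <= rho, 0 <= c0 & 0 <= c1] /\
    [/\ rho0 * A0 <= c0 * B1, rho1 * A1 <= c1 * B0,
        (rho - rho0) * A0 + (rho - rho1) * A1 <= rho * excess A0 A1 + excess B0 B1 &
        rho0 * A0 * c0 ^+ lam + rho1 * A1 * c1 ^+ lam
          <= rho * (A0 + A1) * c ^+ lam * gain].
Proof.
move=> A00 A10 B00 B10 rho0 /andP[c0 c1] cond.
have [a0 [a1 [/andP[a00 aA0] /andP[a10 aA1] aE0 aE1 ->]]] := clip_props A00 A10.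
have [b0 [b1 [/andP[b00 bB0] /andP[b10 bB1] bE0 bE1 ->]]] := clip_props B00 B10.
have cB : c * (B0 + B1) <= B0 + B1 by rewrite ler_piMl // addr_ge0.
have g0 : 0 < gain by exact: expR_gt0.
have E0 : 0 < E by exact: expR_gt0.
(* If a clipped pair vanishes, all the mass can be charged to the error term, with zero weights and
   ratios. When it is the second pair, this uses [rho * (A0 + A1) <= B0 + B1]. *)
have triv : (a0 + a1 = 0) \/ (b0 + b1 = 0) ->
  exists rho0 rho1 c0 c1 : R,
    [/\ 0 <= rho0 <= rho, 0 <= rho1 <= rho, 0 <= c0 & 0 <= c1] /\
    [/\ rho0 * A0 <= c0 * B1, rho1 * A1 <= c1 * B0,
        (rho - rho0) * A0 + (rho - rho1) * A1 <=
          rho * (A0 + A1 - (a0 + a1)) + (B0 + B1 - (b0 + b1)) &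
        rho0 * A0 * c0 ^+ lam + rho1 * A1 * c1 ^+ lam
          <= rho * (A0 + A1) * c ^+ lam * gain].
  move=> ab; exists 0, 0, 0, 0; rewrite !lexx rho0 !mul0r addr0 !subr0 -mulrDr.
  split=> //; split=> //; last by rewrite !mulr_ge0 ?exprn_ge0 ?addr_ge0 // ltW.
  case: ab => ->; first by rewrite subr0; lra.
  have : 0 <= rho * (A0 + A1 - (a0 + a1)) by rewrite mulr_ge0 //; lra.
  lra.
have [a_0|an0] := eqVneq (a0 + a1) 0; first by apply: triv; left.
have [b_0|bn0] := eqVneq (b0 + b1) 0; first by apply: triv; right.
have posE x y : 0 <= x -> 0 <= y -> x <= E * y -> y <= E * x -> x + y != 0 -> 0 < x.
  move=> x0 y0 xy yx; rewrite lt0r x0 andbT; apply: contraNneq => x00.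
  by move: yx; rewrite x00 mulr0 => y1; rewrite add0r; apply/eqP/le_anti; rewrite y0 y1.
have pa0 : 0 < a0 by apply: (posE a0 a1).
have pa1 : 0 < a1 by apply: (posE a1 a0) => //; rewrite addrC.
have pb0 : 0 < b0 by apply: (posE b0 b1).
have pb1 : 0 < b1 by apply: (posE b1 b0) => //; rewrite addrC.
have pA0 : 0 < A0 by exact: lt_le_trans aA0.
have pA1 : 0 < A1 by exact: lt_le_trans aA1.
have pA : 0 < A0 + A1 by exact: addr_gt0.
have pB : 0 < B0 + B1 by apply: addr_gt0; [exact: lt_le_trans bB0|exact: lt_le_trans bB1].
(* [S] is the fraction of the second pair that survives clipping. Scaling the first pair by it as
   well keeps its total at most [c] times that of the second. *)
set S := (b0 + b1) / (B0 + B1).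
have S0 : 0 <= S by rewrite divr_ge0 // addr_ge0.
have S1 : S <= 1 by rewrite ler_pdivrMr // mul1r lerD.
have rr a A : 0 < a -> a <= A -> 0 <= rho * S * (a / A) <= rho.
  move=> a_0 aA; have A_0 := lt_le_trans a_0 aA.
  apply/andP; split; first by rewrite (mulr_ge0 (mulr_ge0 rho0 S0)) // divr_ge0 ?ltW.
  rewrite -[leRHS]mulr1 -mulrA ler_wpM2l //.
  by apply: mulr_ile1 => //; rewrite ?divr_ge0 ?ler_pdivrMr ?mul1r // ltW.
(* Passing to the antipode pairs [A0] with [B1] and [A1] with [B0]. Up to [A0 + A1] in place of
   [a0 + a1], the factors applied to [c] are those of [gain_bound]: [1 + s] and [(1 - t)^-1] here,
   [1 - s] and [(1 + t)^-1] for [c1']. *)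
pose c0' := c * (2 * a0 / (A0 + A1)) * ((b0 + b1) / (2 * b1)).
pose c1' := c * (2 * a1 / (A0 + A1)) * ((b0 + b1) / (2 * b0)).
exists (rho * S * (a0 / A0)), (rho * S * (a1 / A1)), c0', c1'.
split.
  split; rewrite ?rr //; rewrite /c0' /c1' ?mulr_ge0 ?invr_ge0 ?mulr_ge0 ?addr_ge0 //.
have rA0 : rho * S * (a0 / A0) * A0 = rho * S * a0 by rewrite -!mulrA mulVf ?mulr1 ?gt_eqF.
have rA1 : rho * S * (a1 / A1) * A1 = rho * S * a1 by rewrite -!mulrA mulVf ?mulr1 ?gt_eqF.
have key a b B : 0 < a -> 0 < b -> b <= B ->
  rho * S * a <= c * (2 * a / (A0 + A1)) * ((b0 + b1) / (2 * b)) * B.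
  move=> a_0 b_0 bB.
  have -> : rho * S * a = (rho * (A0 + A1)) * ((b0 + b1) * a / ((B0 + B1) * (A0 + A1))).
    by rewrite /S; field; rewrite !gt_eqF.
  apply: (@le_trans _ _ ((c * (B0 + B1)) * ((b0 + b1) * a / ((B0 + B1) * (A0 + A1))))).
    by rewrite ler_wpM2r // mulr_ge0 ?invr_ge0 ?mulr_ge0 ?addr_ge0 // ltW.
  have -> : c * (B0 + B1) * ((b0 + b1) * a / ((B0 + B1) * (A0 + A1)))
    = c * (2 * a / (A0 + A1)) * ((b0 + b1) / (2 * b)) * b.
    by field; rewrite !gt_eqF.
  by rewrite ler_wpM2l // !mulr_ge0 ?invr_ge0 ?mulr_ge0 ?addr_ge0 // ltW.
split; rewrite ?mulrBl ?rA0 ?rA1.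
- exact: key.
- exact: key.
- have -> : rho * A0 - rho * S * a0 + (rho * A1 - rho * S * a1) =
    rho * (A0 + A1 - (a0 + a1)) + rho * (a0 + a1) * (1 - S) by ring.
  rewrite lerD2l.
  apply: (@le_trans _ _ ((B0 + B1) * (1 - S))).
    rewrite ler_wpM2r ?subr_ge0 //; apply: le_trans (le_trans cond cB).
    by rewrite ler_wpM2l // lerD.
  by rewrite mulrBr mulr1 /S mulrC divfK // gt_eqF.
set s := (a0 - a1) / (a0 + a1); set t := (b0 - b1) / (b0 + b1).
have es : `|s| <= eta by exact: ratio_deviation.
have et : `|t| <= eta by exact: ratio_deviation.
have s0 : 1 + s = 2 * a0 / (a0 + a1) by rewrite /s; field.
have s1 : 1 - s = 2 * a1 / (a0 + a1) by rewrite /s; field.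
have t0 : (1 + t)^-1 = (b0 + b1) / (2 * b0).
  by rewrite /t; field; rewrite bn0 gt_eqF // (_ : b0 + b1 + (b0 - b1) = 2 * b0) ?mulf_neq0 ?gt_eqF //; ring.
have t1 : (1 - t)^-1 = (b0 + b1) / (2 * b1).
  by rewrite /t; field; rewrite bn0 gt_eqF // (_ : b0 + b1 - (b0 - b1) = 2 * b1) ?mulf_neq0 ?gt_eqF //; ring.
have := gain_bound es et; rewrite s0 s1 t0 t1 => gb.
have aA : a0 + a1 <= A0 + A1 by rewrite lerD.
have pa : 0 < a0 + a1 by rewrite addr_gt0.
have tm a b : 0 < a -> 0 < b ->
  rho * S * a * (c * (2 * a / (A0 + A1)) * ((b0 + b1) / (2 * b))) ^+ lam <=
  rho * ((A0 + A1) / 2) * c ^+ lam *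
    ((2 * a / (a0 + a1)) ^+ lam.+1 * ((b0 + b1) / (2 * b)) ^+ lam).
  move=> a_0 b_0; rewrite exprS !exprMn.
  have -> : rho * S * a * (c ^+ lam * ((2 ^+ lam * a ^+ lam) * (A0 + A1)^-1 ^+ lam) *
     ((b0 + b1) ^+ lam * (2 * b)^-1 ^+ lam)) =
     (rho * c ^+ lam * (2 ^+ lam * a ^+ lam) * ((b0 + b1) ^+ lam * (2 * b)^-1 ^+ lam)) *
     (S * a * (A0 + A1)^-1 ^+ lam) by ring.
  have -> : rho * ((A0 + A1) / 2) * c ^+ lam * (2 * a / (a0 + a1) *
      (2 ^+ lam * a ^+ lam * (a0 + a1)^-1 ^+ lam) * ((b0 + b1) ^+ lam * (2 * b)^-1 ^+ lam)) =
     (rho * c ^+ lam * (2 ^+ lam * a ^+ lam) * ((b0 + b1) ^+ lam * (2 * b)^-1 ^+ lam)) *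
     (((A0 + A1) / (a0 + a1)) * a * (a0 + a1)^-1 ^+ lam) by field; rewrite gt_eqF.
  apply: ler_wpM2l.
    by rewrite !mulr_ge0 ?exprn_ge0 ?invr_ge0 ?mulr_ge0 ?addr_ge0 // ltW.
  apply: ler_pM.
  - by rewrite mulr_ge0 // ltW.
  - by rewrite exprn_ge0 // invr_ge0 ltW.
  - rewrite ler_wpM2r ?(ltW a_0) //; apply: (le_trans S1).
    by rewrite ler_pdivlMr // mul1r.
  - case: (lam) => [|l]; first by rewrite !expr0.
    by rewrite ler_pXn2r ?nnegrE ?invr_ge0 ?(ltW pA) ?(ltW pa) // lef_pV2 ?posrE.
have := lerD (tm a0 b1 pa0 pb1) (tm a1 b0 pa1 pb0).
rewrite -mulrDr => /le_trans; apply.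
have -> : rho * (A0 + A1) * c ^+ lam * gain = rho * ((A0 + A1) / 2) * c ^+ lam * (2 * gain).
  by field.
by rewrite ler_wpM2l // !mulr_ge0 ?exprn_ge0 ?invr_ge0 // ltW.
Qed.

(** Unfolded, this is the sum over the coordinates of the average excess over the edges of the cube
    in that direction. *)
Fixpoint err (M : nat) h : R :=
  match M with
  | 0 => 0
  | M'.+1 => avg M' (fun v => excess (h (true :: v)) (h (false :: v))) +
             (err M' (fun v => h (true :: v)) + err M' (fun v => h (false :: v))) / 2
  end.

Lemma err_ge0 M h : 0 <= err M h.
Proof.
elim: M h => [//|M IH] h /=; rewrite addr_ge0 //; last by rewrite divr_ge0 ?addr_ge0.
by apply: avg_ge0 => v; rewrite addr_ge0 ?pos_ge0.
Qed.

(** Jensen's inequality for the convex function [pos]. *)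
Lemma excess_avg M f g : excess (avg M f) (avg M g) <= avg M (fun v => excess (f v) (g v)).
Proof.
rewrite /excess avgD; apply: lerD.
  by rewrite -(avgZ M E) -[- avg _ _]mulN1r -avgZ -avgD (le_trans (pos_avg _ _)) // avg_le // => v _; rewrite mulN1r.
by rewrite -(avgZ M E) -[- avg _ _]mulN1r -avgZ -avgD (le_trans (pos_avg _ _)) // avg_le // => v _; rewrite mulN1r.
Qed.

(** A Chernoff bound obtained by revealing one coordinate at a time. The number [c] bounds the ratio
    of [rho * h] to the antipodal [k] and is updated by [clip_step]. At a leaf with [c < 1] the
    positive part is zero; where [c >= 1] it is at most [rho * h * c ^+ lam], and the weighted mean
    of [c ^+ lam] grows by at most [gain] per coordinate. *)
Lemma avg_excess_le M h k rho c : (forall v, 0 <= h v) -> (forall v, 0 <= k v) ->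
  0 <= rho -> 0 <= c -> rho * avg M h <= c * avg M k ->
  avg M (fun v => pos (rho * h v - k (map negb v))) <=
  rho * avg M h * c ^+ lam * gain ^+ M + (rho * err M h + err M k) / 2.
Proof.
have g1 : 1 <= gain.
  rewrite -(expR0 R) ler_expR; case/andP: eta_bnd => e0 _.
  by rewrite addr_ge0 ?mulr_ge0 ?sqr_ge0.
elim: M h k rho c => [|M IH] h k rho c h0 k0 rho0 c0 cond.
  rewrite /= mulr0 addr0 mul0r addr0 expr0 mulr1 pos_le.
  have rh : 0 <= rho * h [::] * c ^+ lam by rewrite !mulr_ge0 ?exprn_ge0.
  rewrite rh andbT; have [c1|c1] := leP 1 c.
    apply: (@le_trans _ _ (rho * h [::])); first by have := k0 [::]; lra.
    by rewrite ler_peMr ?mulr_ge0 // exprn_ege1.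
  apply: le_trans rh; rewrite subr_le0 (le_trans cond) // ler_piMl //=; exact: ltW.
have E0 : 0 <= (rho * err M.+1 h + err M.+1 k) / 2.
  by rewrite divr_ge0 // addr_ge0 ?mulr_ge0 ?err_ge0.
(* Once [c] has reached 1 the bound is trivial at any depth, so [clip_step] is needed only for
   [c < 1]. *)
have [c1|c1] := leP 1 c.
  apply: (@le_trans _ _ (rho * avg M.+1 h)).
    rewrite -avgZ; apply: avg_le => v _; rewrite pos_le mulr_ge0 // andbT.
    by have := k0 (map negb v); lra.
  apply: (@le_trans _ _ (rho * avg M.+1 h * c ^+ lam * gain ^+ M.+1)); last lra.
  have A0 : 0 <= rho * avg M.+1 h by rewrite mulr_ge0 // avg_ge0.
  by rewrite -mulrA ler_peMr // -[1]mulr1 ler_pM // exprn_ege1.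
move: cond E0 => /=.
set h0' := fun v => h (true :: v); set h1 := fun v => h (false :: v).
set k0' := fun v => k (true :: v); set k1 := fun v => k (false :: v).
set A0 := avg M h0'; set A1 := avg M h1; set B0 := avg M k0'; set B1 := avg M k1.
move=> cond _.
have pA0 : 0 <= A0 by apply: avg_ge0 => v; exact: h0.
have pA1 : 0 <= A1 by apply: avg_ge0 => v; exact: h0.
have pB0 : 0 <= B0 by apply: avg_ge0 => v; exact: k0.
have pB1 : 0 <= B1 by apply: avg_ge0 => v; exact: k0.
have cond' : rho * (A0 + A1) <= c * (B0 + B1) by lra.
have c01 : 0 <= c <= 1 by rewrite c0 ltW.
have [r0 [r1 [c0' [c1' [[/andP[r00 r0r] /andP[r10 r1r] c00 c10] [d0 d1 rem main]]]]]] :=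
  clip_step pA0 pA1 pB0 pB1 rho0 c01 cond'.
have exA : excess A0 A1 <= avg M (fun v => excess (h0' v) (h1 v)) by exact: excess_avg.
have exB : excess B0 B1 <= avg M (fun v => excess (k0' v) (k1 v)) by exact: excess_avg.
(* Lowering the weight from [rho] to [r] costs [(rho - r) * avg M f] by subadditivity of [pos]; the
   induction hypothesis treats the rest. *)
have child (f g : seq bool -> R) r c' : (forall v, 0 <= f v) -> (forall v, 0 <= g v) ->
    0 <= r -> r <= rho -> 0 <= c' -> r * avg M f <= c' * avg M g ->
    avg M (fun v => pos (rho * f v - g (map negb v))) <=
    (rho - r) * avg M f + (r * avg M f * c' ^+ lam * gain ^+ M + (rho * err M f + err M g) / 2).
  move=> f0 g0 r_0 rr c_0 cd.
  apply: (@le_trans _ _ (avg M (fun v => (rho - r) * f v + pos (r * f v - g (map negb v))))).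
    apply: avg_le => v _.
    have -> : rho * f v - g (map negb v) = (rho - r) * f v + (r * f v - g (map negb v)) by ring.
    by apply: (le_trans (pos_subadd _ _)); rewrite lerD2r pos_le lexx mulr_ge0 ?subr_ge0.
  rewrite avgD avgZ lerD2l; apply: (le_trans (IH f g r c' f0 g0 r_0 c_0 cd)).
  by rewrite lerD2l ler_pM2r ?invr_gt0 // lerD2r ler_wpM2r // err_ge0.
(* Negation also flips the first bit, hence the crossed halves. *)
have C0 := child h0' k1 r0 c0' (fun v => h0 _) (fun v => k0 _) r00 r0r c00 d0.
have C1 := child h1 k0' r1 c1' (fun v => h0 _) (fun v => k0 _) r10 r1r c10 d1.
rewrite -/A0 -/A1 in C0 C1.
have mg : (r0 * A0 * c0' ^+ lam + r1 * A1 * c1' ^+ lam) * gain ^+ M <=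
    rho * (A0 + A1) * c ^+ lam * gain * gain ^+ M.
  by rewrite ler_wpM2r // exprn_ge0 // (le_trans _ g1).
have rex : rho * excess A0 A1 <= rho * avg M (fun v => excess (h0' v) (h1 v)).
  by rewrite ler_wpM2l.
rewrite exprS.
set X := avg M (fun v => excess (h0' v) _) in rex *.
set Y := avg M (fun v => excess (k0' v) _) in exB *.
lra.
Qed.

End cube_expectation.

(** * Privacy on the cube *)

Section indistinguishability.
Context (R : realType) (O : finType).
Implicit Types (p q r : O -> R) (eps delta : R).

Definition indist eps delta p q : bool :=
  [forall T : {set O}, \sum_(o in T) p o <= expR eps * (\sum_(o in T) q o) + delta].

Lemma indistP eps delta p q :
  reflect (forall T : {set O}, \sum_(o in T) p o <= expR eps * (\sum_(o in T) q o) + delta)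
          (indist eps delta p q).
Proof. exact: forallP. Qed.

(** The worst event consists of the outputs with [p o > expR eps * q o]. The hockey-stick form is a
    sum over outputs, so it can be averaged over the cube one output at a time. *)
Lemma indist_hockey eps delta p q :
  indist eps delta p q = (\sum_o pos (p o - expR eps * q o) <= delta).
Proof.
apply/indistP/idP => [H|H T].
  have := H [set o | 0 < p o - expR eps * q o]%SET.
  rewrite -lerBlDl mulr_sumr -sumrB; apply: le_trans.
  rewrite [in leRHS]big_mkcond /=; apply: ler_sum => o _.
  by rewrite inE /pos; case: ltP => // h; rewrite pos_le lexx h.
rewrite -lerBlDl mulr_sumr -sumrB; apply: le_trans H.
rewrite big_mkcond /=; apply: ler_sum => o _.
by case: ifP => _; rewrite ?pos_ge ?pos_ge0.
Qed.

Lemma indist_trans eps1 eps2 delta1 delta2 p q r :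
  indist eps1 delta1 p q -> indist eps2 delta2 q r ->
  indist (eps1 + eps2) (expR eps1 * delta2 + delta1) p r.
Proof.
move=> /indistP pq /indistP qr; apply/indistP => T; apply: (le_trans (pq T)).
rewrite addrA lerD2r expRD -mulrA -mulrDr ler_pM2l ?expR_gt0 //; exact: qr.
Qed.

Lemma indist_le eps1 eps2 delta1 delta2 p q : (forall o, 0 <= q o) ->
  eps1 <= eps2 -> delta1 <= delta2 -> indist eps1 delta1 p q -> indist eps2 delta2 p q.
Proof.
move=> q0 e d /indistP pq; apply/indistP => T; apply: (le_trans (pq T)).
by rewrite lerD // ler_wpM2r ?ler_expR // sumr_ge0.
Qed.

Lemma indist_refl eps delta p : (forall o, 0 <= p o) ->
  0 <= eps -> 0 <= delta -> indist eps delta p p.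
Proof.
move=> p0 e d; apply/indistP => T; rewrite -[leLHS]addr0 lerD //.
by rewrite ler_peMl ?sumr_ge0 // -expR0 ler_expR.
Qed.

End indistinguishability.

(** * Concentration of the Hamming distance *)

Section cube_concentration.
Context (R : realType).
Implicit Types (f : seq bool -> R) (v w : seq bool).

Fixpoint ham v w : nat :=
  match v, w with
  | a :: v', b :: w' => (a != b) + ham v' w'
  | _, _ => 0
  end.

Lemma ham_refl v : ham v v = 0%N.
Proof. by elim: v => //= a v ->; rewrite eqxx. Qed.

Lemma hamC v w : ham v w = ham w v.
Proof. by elim: v w => [|a v IH] [|b w] //=; rewrite IH eq_sym. Qed.

Lemma ham_le_size v w : (ham v w <= size v)%N.
Proof. by elim: v w => [|a v IH] [|b w] //=; have := IH w; case: eqP => _ /=; lia. Qed.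

Lemma ham_triangle v w u : size v = size w -> size w = size u ->
  (ham v u <= ham v w + ham w u)%N.
Proof.
elim: v w u => [|a v IH] [|b w] [|c u] //= [vw] [wu].
by have := IH w u vw wu; case: a; case: b; case: c => /=; lia.
Qed.

Lemma ham_negb v w : ham (map negb v) (map negb w) = ham v w.
Proof. by elim: v w => [|a v IH] [|b w] //=; rewrite IH; case: a; case: b. Qed.

Lemma ham_eq0 v w : size v = size w -> ham v w = 0%N -> v = w.
Proof.
by elim: v w => [|a v IH] [|b w] //= [vw]; case: eqP => //= -> /(IH _ vw) ->.
Qed.

Lemma ham_step v w j : size v = size w -> ham v w = j.+1 ->
  exists u, [/\ size u = size v, ham v u = 1%N & ham u w = j].
Proof.
elim: v w j => [|a v IH] [|b w] j //= [vw].
case: (eqVneq a b) => [<-|ab] /=.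
  rewrite add0n => /(IH _ _ vw)[u [su vu uw]].
  by exists (a :: u); rewrite /= eqxx su.
by rewrite add1n => -[hj]; exists (b :: v); rewrite /= ab eqxx ham_refl hj.
Qed.

Definition lipschitz M f := forall v w, size v = M -> size w = M ->
  `|f v - f w| <= (ham v w)%:R.

(** Bounded differences: the averages over the two half-cubes differ by at most 1, so [cosh_le] at
    [s * (F0 - F1) / 2] costs a factor [expR (s ^+ 2 / 2)] per coordinate. *)
Lemma avg_mgf M f (s : R) : lipschitz M f ->
  avg M (fun v => expR (s * f v)) <= expR (s * avg M f + s ^+ 2 / 2 * M%:R).
Proof.
elim: M f => [|M IH] f lip /=; first by rewrite mulr0 addr0.
have lt a : lipschitz M (fun v => f (a :: v)).
  by move=> v w sv sw; have := lip (a :: v) (a :: w); rewrite /= sv sw eqxx; apply.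
have dF : `|avg M (fun v => f (true :: v)) - avg M (fun v => f (false :: v))| <= 1.
  have d a b : avg M (fun v => f (a :: v)) <= avg M (fun v => f (b :: v)) + 1.
    rewrite -[X in _ + X](avg_cst M) -avgD; apply: avg_le => v sv.
    have := lip (a :: v) (b :: v); rewrite /= sv ham_refl addn0 => /(_ erefl erefl).
    rewrite ler_norml => /andP[_]; case: eqP => /= _; lra.
  by have := d true false; have := d false true; rewrite ler_norml; lra.
set F0 := avg M (fun v => f (true :: v)) in dF *.
set F1 := avg M (fun v => f (false :: v)) in dF *.
have I0 := IH _ (lt true); have I1 := IH _ (lt false).
rewrite -/F0 -/F1 in I0 I1.
set x := s * ((F0 - F1) / 2).
have := cosh_le x.
have x2 : 2 * x ^+ 2 <= s ^+ 2 / 2.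
  have : (F0 - F1) ^+ 2 <= 1.
    by rewrite -(real_normK (num_real (F0 - F1))) -(expr1n _ 2) ler_sqr ?nnegrE.
  move=> /(ler_wpM2l (sqr_ge0 s)); rewrite /x; lra.
rewrite -(ler_expR _ (s ^+ 2 / 2)) in x2 => cx.
have -> : s * ((F0 + F1) / 2) + s ^+ 2 / 2 * M.+1%:R =
  s * ((F0 + F1) / 2) + s ^+ 2 / 2 * M%:R + s ^+ 2 / 2 by rewrite -(natr1 M); ring.
set m := s * ((F0 + F1) / 2) + s ^+ 2 / 2 * M%:R.
have e0 : s * F0 + s ^+ 2 / 2 * M%:R = m + x by rewrite /m /x; field.
have e1 : s * F1 + s ^+ 2 / 2 * M%:R = m - x by rewrite /m /x; field.
rewrite e0 in I0; rewrite e1 in I1.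
rewrite expRD in I0; rewrite expRD in I1; rewrite expRD.
have := ler_wpM2l (expR_ge0 m) (le_trans cx (ler_wpM2l (ler0n _ 2) x2)).
lra.
Qed.

(** The distance [f] to [G] is Lipschitz and vanishes on half of the cube. The moment bound at [- s]
    therefore controls the mean of [f], through [expR (s * avg M f) <= 2 * expR (s ^+ 2 / 2 * M)],
    and the moment bound at [s] then gives the tail. *)
Lemma cube_isoperimetry M (G : pred (seq bool)) (s k : R) : 0 <= s ->
  2^-1 <= @avg R M (fun v => (G v)%:R) ->
  @avg R M (fun v => (`[< forall w, size w = M -> G w -> k < (ham v w)%:R >])%:R)
    <= 2 * expR (- (s * k) + s ^+ 2 * M%:R).
Proof.
move=> s0 G2.
have [w0 sw0 Gw0] : exists2 w, size w = M & G w.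
  apply: contrapT => nG; have : @avg R M (fun v => (G v)%:R) <= 0.
    rewrite -(avg_cst M 0); apply: avg_le => v sv.
    by case Gv : (G v) => //; exfalso; apply: nG; exists v.
  move: G2; lra.
pose near v j := `[< exists w, [/\ size w = M, G w & (ham v w <= j)%N] >].
have exn v : exists j, near v j by exists (ham v w0); apply/asboolP; exists w0.
pose f v : R := (ex_minn (exn v))%:R.
have fle v w : size w = M -> G w -> f v <= (ham v w)%:R.
  move=> sw Gw; rewrite /f ler_nat; case: ex_minnP => j _; apply.
  by apply/asboolP; exists w.
have fex v : exists w, [/\ size w = M, G w & (ham v w)%:R <= f v].
  rewrite /f; case: ex_minnP => j /asboolP[w [sw Gw h]] _.
  by exists w; rewrite ler_nat.
have lip : lipschitz M f.
  have d v w : size v = M -> size w = M -> f v <= f w + (ham v w)%:R.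
    move=> sv sw; have [u [su Gu hu]] := fex w.
    apply: (le_trans (fle v u su Gu)); apply: le_trans (lerD hu (lexx _)).
    by rewrite -natrD ler_nat addnC ham_triangle // ?sv ?sw ?su.
  move=> v w sv sw; have := d v w sv sw; have := d w v sw sv.
  by rewrite (hamC w v) ler_norml; lra.
have lo := avg_mgf (- s) lip; have up := avg_mgf s lip.
rewrite sqrrN mulNr in lo.
have G2' : 2^-1 <= avg M (fun v => expR (- s * f v)).
  apply: (le_trans G2); apply: avg_le => v sv.
  case Gv : (G v); last exact: expR_ge0.
  have := fle v v sv Gv; rewrite ham_refl => f0.
  have -> : f v = 0 by apply/le_anti; rewrite f0 /f ler0n.
  by rewrite mulr0 expR0.
apply: (@le_trans _ _ (expR (- (s * k)) * avg M (fun v => expR (s * f v)))).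
  rewrite -avgZ; apply: avg_le => v sv.
  case: asboolP => [H|_]; last by rewrite mulr_ge0 ?expR_ge0.
  rewrite -expRD -[leLHS]expR0 ler_expR addrC subr_ge0 ler_wpM2l //.
  have [w [sw Gw hw]] := fex v.
  by apply: le_trans hw; apply/ltW/H.
have E2 : expR (s * avg M f) <= 2 * expR (s ^+ 2 / 2 * M%:R).
  have := le_trans G2' lo; rewrite expRD expRN mulrC => h.
  move: h; rewrite ler_pdivlMr ?expR_gt0 //; lra.
rewrite expRD in up.
apply: (le_trans (ler_wpM2l (expR_ge0 _) up)).
apply: (@le_trans _ _ (expR (- (s * k)) * ((2 * expR (s ^+ 2 / 2 * M%:R)) * expR (s ^+ 2 / 2 * M%:R)))).
  by rewrite ler_pM2l ?expR_gt0 // ler_pM2r ?expR_gt0.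
have -> : s ^+ 2 * M%:R = s ^+ 2 / 2 * M%:R + s ^+ 2 / 2 * M%:R by field.
by rewrite !expRD le_eqVlt; apply/orP; left; apply/eqP; ring.
Qed.

End cube_concentration.

(** * Closeness of antipodal distributions *)

Section cube_privacy.
Context (R : realType) (O : finType).
Variables (M : nat) (P : seq bool -> O -> R) (eta zeta : R).
Hypothesis P_ge0 : forall v o, 0 <= P v o.
Hypothesis P_sum1 : forall v, \sum_o P v o = 1.
Hypothesis P_dp : forall v w, size v = M -> size w = M -> ham v w = 1%N ->
  indist eta zeta (P v) (P w).
Hypothesis eta_bnd : 0 <= eta <= 2^-1.
Hypothesis zeta_ge0 : 0 <= zeta.

(** Summed over the outputs, an edge has excess at most [zeta] in each of its two directions, and
    [err] has one averaged term per coordinate. *)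
Lemma sum_err_le (N : nat) (Q : seq bool -> O -> R) :
  (forall v w, size v = N -> size w = N -> ham v w = 1%N -> indist eta zeta (Q v) (Q w)) ->
  \sum_o err eta N (Q ^~ o) <= 2 * zeta * N%:R.
Proof.
elim: N Q => [|N IH] Q dp /=; first by rewrite big1 // mulr0.
rewrite big_split /= -avg_sum -mulr_suml big_split /=.
have dpa a v w : size v = N -> size w = N -> ham v w = 1%N ->
    indist eta zeta (Q (a :: v)) (Q (a :: w)).
  by move=> sv sw h; apply: dp; rewrite /= ?sv ?sw ?eqxx ?h.
have := IH (fun v => Q (true :: v)) (dpa true); have := IH (fun v => Q (false :: v)) (dpa false).
have : avg N (fun v => \sum_o excess eta (Q (true :: v) o) (Q (false :: v) o)) <= 2 * zeta.
  rewrite -[leRHS](avg_cst N); apply: avg_le => v sv; rewrite big_split /=.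
  have := dp (true :: v) (false :: v); have := dp (false :: v) (true :: v).
  rewrite /= sv ham_refl !indist_hockey => /(_ erefl erefl erefl) + /(_ erefl erefl erefl).
  lra.
rewrite -(natr1 N); lra.
Qed.

Lemma indist_group v w : size v = M -> size w = M ->
  indist ((ham v w)%:R * eta) ((ham v w)%:R * zeta * expR ((ham v w)%:R * eta)) (P v) (P w).
Proof.
have [j jE] := ubnP (ham v w); elim: j v w jE => // j IH v w.
case h : (ham v w) => [|i] ij sv sw.
  by rewrite !mul0r (ham_eq0 _ h) ?sv ?sw // indist_refl.
have [u [su vu uw]] := ham_step (etrans sv (esym sw)) h.
rewrite sv in su.
have c1 := P_dp sv su vu.
have c2 : indist (i%:R * eta) (i%:R * zeta * expR (i%:R * eta)) (P u) (P w).
  by rewrite -uw; apply: IH => //; rewrite uw; lia.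
apply: indist_le (indist_trans c1 c2) => //.
  by rewrite -natr1; lra.
have -> : i.+1%:R * eta = eta + i%:R * eta by rewrite -natr1; ring.
rewrite -natr1 expRD.
have e1 : 1 <= expR eta * expR (i%:R * eta).
  rewrite -expRD -expR0 ler_expR; case/andP: eta_bnd => e0 _.
  by rewrite addr_ge0 // mulr_ge0.
have := ler_wpM2l zeta_ge0 e1; lra.
Qed.

(** This applies [avg_excess_le] output by output with equal functions. Taking [expR (- t)] both as
    weight and as initial ratio turns its hypothesis into an equality, and the [lam]-th power of the
    ratio yields the decay [expR (- (t * lam))]. *)
Lemma avg_hockey_le (t : R) (lam : nat) : 0 <= t ->
  avg M (fun v => \sum_o pos (P v o - expR t * P (map negb v) o)) <=
  expR (- (t * lam%:R)) *
    expR (2 * lam%:R * eta ^+ 2 + 2 * ((2 * lam + 1)%:R * eta) ^+ 2) ^+ M +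
  (1 + expR t) * (M%:R * zeta).
Proof.
move=> t0; set g := (X in expR X ^+ M).
pose rho := expR (- t).
have rho0 : 0 < rho by exact: expR_gt0.
have tr : expR t * rho = 1 by rewrite -expRD subrr expR0.
have bnd o := @avg_excess_le R eta lam eta_bnd M (P ^~ o) (P ^~ o) rho rho
  (fun v => P_ge0 v o) (fun v => P_ge0 v o) (ltW rho0) (ltW rho0) (lexx _).
have posM (x : R) : pos (expR t * x) = expR t * pos x.
  by rewrite /pos maxr_pMr ?mulr0 // expR_ge0.
have -> : avg M (fun v => \sum_o pos (P v o - expR t * P (map negb v) o)) =
    expR t * \sum_o avg M (fun v => pos (rho * P v o - P (map negb v) o)).
  rewrite -avg_sum -avgZ; apply: eq_avg => v sv; rewrite mulr_sumr.
  by apply: eq_bigr => o _; rewrite -posM mulrBr mulrA tr mul1r.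
apply: (le_trans (ler_wpM2l (expR_ge0 t) (ler_sum _ (fun o _ => bnd o)))).
have er := sum_err_le P_dp.
set er' := \sum_o err _ _ _ in er *.
have avg1 : \sum_o avg M (P ^~ o) = 1.
  by rewrite -avg_sum; under eq_avg => v _ do rewrite P_sum1; exact: avg_cst.
rewrite big_split /= -!mulr_suml big_split /= -!mulr_sumr avg1 -/er' -/g.
rewrite mulr1 mulrDr !mulrA tr mul1r.
have -> : rho ^+ lam = expR (- (t * lam%:R)) by rewrite -mulNr expRM_natr.
rewrite lerD2l.
have -> : expR t * (rho * er' + er') / 2 = (1 + expR t) * (er' / 2).
  by rewrite mulrDr mulrA tr; field.
by rewrite -[leRHS]mulrA ler_pM2l ?addr_gt0 ?expR_gt0 //; lra.
Qed.

(* Expectation and Markov make half of the cube good at level [t]; a typical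
   point is then within [k] flips of a good one, and group privacy pays for them. *)
Lemma cube_indist_whp (t k s delta : R) (lam : nat) :
  0 <= t <= 2^-1 -> 0 <= s -> k * eta <= 8^-1 -> 0 < delta ->
  32 * (M%:R * zeta) <= delta ->
  expR (- (t * lam%:R)) *
    expR (2 * lam%:R * eta ^+ 2 + 2 * ((2 * lam + 1)%:R * eta) ^+ 2) ^+ M <= delta / 8 ->
  @avg R M (fun v => (~~ indist (t + 2 * (k * eta)) delta (P v) (P (map negb v)))%:R)
    <= 2 * expR (- (s * k) + s ^+ 2 * M%:R).
Proof.
move=> /andP[t0 t1] s0 ke d0 Mz lamb.
have et : expR t <= 2 by apply: (le_trans (expR_le1D2 _)); rewrite ?t0 //; lra.
pose H v := \sum_o pos (P v o - expR t * P (map negb v) o).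
have Hge0 v : 0 <= H v by apply: sumr_ge0 => o _; exact: pos_ge0.
have Mz0 : 0 <= M%:R * zeta by rewrite mulr_ge0.
have avgH : avg M H <= delta / 4.
  apply: (le_trans (avg_hockey_le lam t0)).
  have := ler_wpM2r Mz0 (lerD (lexx 1) et); lra.
(* This is twice the bound on the mean of [H], so Markov's inequality puts half of the cube in
   [G]. *)
pose G v := H v <= delta / 2.
have G2 : 2^-1 <= @avg R M (fun v => (G v)%:R).
  have : avg M (fun v => delta / 2 * (1 - (G v)%:R)) <= avg M H.
    apply: avg_le => v _; rewrite /G; have := Hge0 v.
    by case: (leP (H v)) => h h0; rewrite ?mulr1n ?mulr0n; lra.
  rewrite avgZ; under eq_avg => v _ do rewrite -[- _]mulN1r.
  rewrite avgD avg_cst avgZ => h.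
  have := le_trans h avgH; set g := avg _ _ => hh.
  have : delta / 2 * (1 + -1 * g) <= delta / 2 * 2^-1 by lra.
  by rewrite ler_pM2l ?divr_gt0 //; lra.
apply: le_trans (cube_isoperimetry k s0 G2); apply: avg_le => v sv.
case: asboolP => [_|]; first by case: (indist _ _ _ _).
move=> /existsNP[w /not_implyP[sw /not_implyP[Gw /negP]]].
rewrite -leNgt => hk.
suff -> : indist (t + 2 * (k * eta)) delta (P v) (P (map negb v)) by [].
case/andP: eta_bnd => e0 _.
set j := ham v w in hk *.
have je : j%:R * eta <= k * eta by rewrite ler_wpM2r.
have je0 : 0 <= j%:R * eta by rewrite mulr_ge0.
have ee : expR (j%:R * eta) <= 5 / 4.
  by apply: (le_trans (expR_le1D2 _)); rewrite ?je0 /=; lra.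
have jz : j%:R * zeta <= M%:R * zeta.
  by rewrite ler_wpM2r // ler_nat -sv ham_le_size.
have jz0 : 0 <= j%:R * zeta by rewrite mulr_ge0.
(* The path runs from [v] to [w], across to the antipode of [w], and on to the antipode of [v]; its
   outer legs have the same length [j]. *)
have c1 := indist_group sv sw; rewrite -/j in c1.
have c2 : indist t (delta / 2) (P w) (P (map negb w)) by rewrite indist_hockey.
have c3 := @indist_group (map negb w) (map negb v).
rewrite !size_map sv sw ham_negb (hamC w) -/j in c3.
have {}c3 := c3 erefl erefl.
have := indist_trans c1 (indist_trans c2 c3).
apply: indist_le => //; first lra.
set x := expR (j%:R * eta) in ee *; have x0 : 0 <= x by exact: expR_ge0.
set z := j%:R * zeta in jz jz0 *.
have zx : z * x <= z * (5 / 4) by rewrite ler_wpM2l.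
have zx0 : 0 <= z * x by rewrite mulr_ge0.
have : expR t * (z * x) <= 2 * (z * x) by rewrite ler_wpM2r.
move=> h; have h2 : expR t * (z * x) + delta / 2 <= 2 * (z * (5 / 4)) + delta / 2 by lra.
have := ler_wpM2l x0 h2.
have h3 : 0 <= 2 * (z * (5 / 4)) + delta / 2 by lra.
have := ler_wpM2r h3 ee; lra.
Qed.

End cube_privacy.

(** * Selections of i.i.d. items *)

Section item_selection.
Context (R : realType) (d : measure_display) (Z : measurableType d).

Definition item (n m : nat) (x : n.-tuple (m.-tuple Z)) (a : 'I_n * 'I_m) : Z :=
  tnth (tnth x a.1) a.2.

Definition sel (n m n' m' : nat) (phi : 'I_n' * 'I_m' -> 'I_n * 'I_m)
    (x : n.-tuple (m.-tuple Z)) : n'.-tuple (m'.-tuple Z) :=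
  [tuple [tuple item x (phi (i, j)) | j < m'] | i < n'].

Lemma item_sel n m n' m' (phi : 'I_n' * 'I_m' -> 'I_n * 'I_m) x a :
  item (sel phi x) a = item x (phi a).
Proof. by case: a => i j; rewrite /item !tnth_mktuple. Qed.

Lemma eq_from_item n m (x y : n.-tuple (m.-tuple Z)) : item x =1 item y -> x = y.
Proof.
move=> xy; apply: eq_from_tnth => i; apply: eq_from_tnth => j; exact: (xy (i, j)).
Qed.

Lemma measurable_item n m a : measurable_fun setT (fun x => @item n m x a).
Proof.
rewrite /item; apply: (measurableT_comp (f := fun y : m.-tuple Z => tnth y a.2)).
  exact: measurable_tnth.
exact: measurable_tnth.
Qed.

Lemma measurable_fun_items d1 (T1 : measurableType d1) n m (f : T1 -> n.-tuple (m.-tuple Z)) :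
  (forall a, measurable_fun setT (fun t => item (f t) a)) -> measurable_fun setT f.
Proof.
move=> mf; apply/measurable_fun_tnthP => i; apply/measurable_fun_tnthP => j.
exact: (mf (i, j)).
Qed.

Lemma measurable_sel n m n' m' (phi : 'I_n' * 'I_m' -> 'I_n * 'I_m) :
  measurable_fun setT (@sel n m n' m' phi).
Proof.
apply: measurable_fun_items => a; under eq_fun do rewrite item_sel.
exact: measurable_item.
Qed.

Definition item_box n m (B : 'I_n * 'I_m -> set Z) : set (n.-tuple (m.-tuple Z)) :=
  [set x | forall a, B a (item x a)].

Lemma iid_item_box (D : probability Z R) n m (B : 'I_n * 'I_m -> set Z) :
  (forall a, measurable (B a)) -> iid (iid D m) n (item_box B) = (\prod_a D (B a))%E.
Proof.
move=> mB.
pose row i := [set y : m.-tuple Z | forall j, B (i, j) (tnth y j)].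
have mrow i : measurable (row i).
  rewrite (_ : row i = \bigcap_(j in [set: 'I_m]) ((fun y => tnth y j) @^-1` B (i, j))).
    apply: fin_bigcap_measurable => // j _; rewrite -[X in measurable X]setTI.
    exact: measurable_tnth.
  by apply/seteqP; split => y /= By j; [move=> _|]; exact: By.
rewrite (_ : item_box B = [set x | forall i, row i (tnth x i)]).
  rewrite (iid_box _ mrow) (eq_bigr (fun i => \prod_j D (B (i, j)))%E) => [|i _].
    by rewrite pair_bigA /=; apply: eq_bigr => -[].
  exact: (iid_box D (B := fun j => B (i, j))).
by apply/seteqP; split => x /=; [move=> Bx i j; exact: (Bx (i, j))|move=> Bx -[i j]; exact: Bx].
Qed.

(** Both sides are finite measures, and boxes are stable under intersection and generate the
    sigma-algebra, so agreement on boxes suffices. Injectivity makes the preimage of a box a box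
    again. *)
Lemma iid_sel (D : probability Z R) n m n' m' (phi : 'I_n' * 'I_m' -> 'I_n * 'I_m) :
  injective phi -> forall A, measurable A ->
  pushforward (iid (iid D m) n) (sel phi) A = iid (iid D m') n' A.
Proof.
move=> phiI.
pose G := [set A | exists2 B : 'I_n' * 'I_m' -> set Z,
  (forall a, measurable (B a)) & A = item_box B].
have mbox B : (forall a, measurable (B a)) -> measurable (@item_box n' m' B).
  move=> mB; rewrite (_ : item_box B = \bigcap_(a in setT) ((fun x => item x a) @^-1` B a)).
    apply: fin_bigcap_measurable => // a _; rewrite -[X in measurable X]setTI.
    exact: measurable_item.
  by apply/seteqP; split => y /= By j; [move=> _|]; exact: By.
have GT : G setT.
  by exists (fun _ => setT) => //; apply/seteqP; split.
apply: (@measure_unique _ R _ G (fun _ => setT)).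
- apply/seteqP; split; last first.
    apply: smallest_sub; first exact: sigma_algebra_measurable.
    by move=> _ [B mB ->]; exact: mbox.
  pose T' := g_sigma_algebraType G.
  have idm : measurable_fun setT (id : T' -> n'.-tuple (m'.-tuple Z)).
    apply: measurable_fun_items => a _ B mB; rewrite setTI; apply: sub_sigma_algebra.
    exists (fun a' => if a' == a then B else setT).
      by move=> a'; case: ifP.
    apply/seteqP; split => x /=; first by move=> Bx a'; case: eqP => // ->.
    by move=> /(_ a); rewrite eqxx.
  by move=> A mA; have := idm measurableT A mA; rewrite setTI.
- move=> _ _ [B mB ->] [C mC ->]; exists (fun a => B a `&` C a).
    by move=> a; exact: measurableI.
  apply/seteqP; split => x /=; first by move=> [Bx Cx] a; split.
  by move=> BCx; split => a; have [] := BCx a.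
- by [].
- by rewrite bigcup_const.
- exact: measurable_sel.
- move=> ? _ [B mB ->].
  (* The preimage box constrains only the cells in the range of [phi]; every other cell contributes
     a factor 1 to the product. *)
  pose inv a := [pick b | phi b == a].
  have invK b : inv (phi b) = Some b.
    by rewrite /inv; case: pickP => [c /eqP /phiI ->//|/(_ b)]; rewrite eqxx.
  pose B' a := if inv a is Some b then B b else setT.
  change (iid (iid D m) n (sel phi @^-1` item_box B) = iid (iid D m') n' (item_box B)).
  rewrite (_ : sel phi @^-1` item_box B = item_box B').
    rewrite !iid_item_box //; last by move=> a; rewrite /B'; case: (inv a).
    rewrite (bigID (fun a => inv a : bool)) /= [X in (_ * X)%E]big1 => [|a].
      rewrite mule1 (reindex_omap phi inv) => [|a].
        by apply: eq_big => [b|b _]; rewrite /B' ?invK ?eqxx.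
      by rewrite /inv; case: pickP => //= b /eqP ->.
    by rewrite /B'; case: (inv a) => // _; rewrite probability_setT.
  apply/seteqP; split => x /= Bx a.
    rewrite /B' /inv; case: pickP => // b /eqP <-.
    by rewrite -item_sel; exact: Bx.
  by rewrite item_sel; have := Bx (phi a); rewrite /B' invK.
- move=> msel _.
  change (iid (iid D m) n (sel phi @^-1` setT) < +oo)%E.
  by rewrite preimage_setT probability_setT ltry.
Qed.

Lemma integral_sel (D : probability Z R) n m n' m' (phi : 'I_n' * 'I_m' -> 'I_n * 'I_m)
    (f : n'.-tuple (m'.-tuple Z) -> R) :
  injective phi -> measurable_fun setT f -> (forall y, 0 <= f y) ->
  (\int[iid (iid D m) n]_x (f (sel phi x))%:E = \int[iid (iid D m') n']_y (f y)%:E)%E.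
Proof.
move=> phiI mf f0.
transitivity (\int[pushforward (iid (iid D m) n) (sel phi)]_y (f y)%:E)%E.
  have mE : measurable_fun setT (fun y => (f y)%:E) by exact: measurableT_comp.
  rewrite (ge0_integral_pushforward (measurable_sel phi) _ measurableT mE) //.
  by move=> y _; rewrite lee_fin.
apply: eq_measure_integral; first exact: measurable_sel.
by move=> msel A mA _; exact: (iid_sel D phiI mA).
Qed.

End item_selection.

(** * Amplification by subsampling *)

Section injections.
Context (I : finType) (N : nat).
Implicit Types (f : {ffun 'I_N -> I}) (C : {set I}).

Definition injs C : {set {ffun 'I_N -> I}} := [set f in ffun_on (mem C) | injectiveb f]%SET.

Lemma injsP C f : reflect ((forall i, f i \in C) /\ injective f) (f \in injs C).
Proof.
rewrite inE; apply: (iffP andP) => [[/ffun_onP fC /injectiveP fI]|[fC fI]]; split => //.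
  exact/ffun_onP.
exact/injectiveP.
Qed.

Lemma card_injs_gt0 C : (N <= #|C|)%N -> (0 < #|injs C|)%N.
Proof. by move=> NC; rewrite /injs card_inj_ffuns_on card_ord ffact_gt0. Qed.

Definition postcomp (s : I -> I) f : {ffun 'I_N -> I} := [ffun i => s (f i)].

Lemma postcompK s : involutive s -> involutive (postcomp s).
Proof. by move=> sK f; apply/ffunP => i; rewrite !ffunE sK. Qed.

Lemma postcomp_injs s C C' f : involutive s -> (forall a, (s a \in C') = (a \in C)) ->
  (postcomp s f \in injs C') = (f \in injs C).
Proof.
move=> sK sC; apply/injsP/injsP => -[fC fI]; split => [i|i j].
- by have := fC i; rewrite ffunE sC.
- by move=> fij; apply: fI; rewrite !ffunE fij.
- by rewrite ffunE sC.
- by rewrite !ffunE => /(inv_inj sK); exact: fI.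
Qed.

Lemma sum_postcomp (R : realType) s C C' (F : {ffun 'I_N -> I} -> R) :
  involutive s -> (forall a, (s a \in C') = (a \in C)) ->
  \sum_(f in injs C') F f = \sum_(f in injs C) F (postcomp s f).
Proof.
move=> sK sC; rewrite (reindex_inj (inv_inj (postcompK sK))) /=.
by apply: eq_bigl => f; exact: postcomp_injs.
Qed.

End injections.

Section amplification.
Context (R : realType) (I : finType) (N : nat).
Implicit Types (f : {ffun 'I_N -> I}) (C : {set I}).

(* Averaging over the transpositions [tperm a b], [b] in [C], moves the item [a]
   to a uniformly random cell. *)
Lemma sum_tperm_codom C (a : I) (F : {ffun 'I_N -> I} -> R) : a \in C ->
  \sum_(b in C) \sum_(f in injs N C | a \in codom f) F (postcomp (tperm a b) f) =
  N%:R * \sum_(f in injs N C) F f.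
Proof.
move=> aC; rewrite (eq_bigr (fun b => \sum_(f in injs N C | b \in codom f) F f)); last first.
  move=> b bC; rewrite [RHS](reindex_inj (inv_inj (postcompK (tpermK a b)))) /=.
  apply: eq_bigl => f; rewrite (postcomp_injs (C := C) _ (tpermK a b)); last first.
    by move=> c; case: tpermP => [->|->|] //; rewrite aC bC.
  congr (_ && _); apply/codomP/codomP => -[i e]; exists i.
    by rewrite ffunE -e tpermL.
  by move: e; rewrite ffunE => e; rewrite -(tpermK a b (f i)) -e tpermR.
rewrite (exchange_big_dep (fun f => f \in injs N C)) /=; last by move=> b f _ /andP[].
rewrite mulr_sumr; apply: eq_bigr => f fI.
rewrite sumr_const mulr_natl; congr (_ *+ _).
case/injsP: (fI) => fC finj.
rewrite -[RHS](card_ord N) -(card_codom finj); apply: eq_card => b.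
rewrite -[LHS]/((b \in C) && ((f \in injs N C) && (b \in codom f))) fI /=.
case: (boolP (b \in codom f)) => [/codomP[i ->]|]; rewrite ?andbF ?fC //.
Qed.

(** [F] and [F'] are meant as acceptance probabilities on two data sets that differ in the item [a].
    Only selections containing [a] tell them apart. Replacing [a] by a uniform cell, through
    [sum_tperm_codom], bounds the part of the sum of [F'] over such selections by about [q] times
    the whole, and only that part pays [e - 1]. *)
Lemma amplification C (a : I) (F F' : {ffun 'I_N -> I} -> R) (e e2 d d2 : R) :
  a \in C -> (N <= #|C|)%N -> 1 <= e ->
  (forall f, f \in injs N C -> a \notin codom f -> F f = F' f) ->
  (forall f, f \in injs N C -> F f <= e * F' f + d) ->
  (forall f b, f \in injs N C -> b \in C ->
     F' f <= e2 * F' (postcomp (tperm a b) f) + d2) ->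
  forall q w, q = N%:R / #|C|%:R -> w = #|injs N C|%:R^-1 ->
  w * \sum_(f in injs N C) F f <=
    (1 + (e - 1) * e2 * q) * (w * \sum_(f in injs N C) F' f) + ((e - 1) * d2 + d) * q.
Proof.
move=> aC NC e1 H1 H2 H3 q w qE wE.
have K0 : 0 < #|C|%:R :> R by rewrite ltr0n; apply/card_gt0P; exists a.
have J0 : 0 < #|injs N C|%:R :> R by rewrite ltr0n card_injs_gt0.
set J := #|injs N C|%:R in wE J0 *.
pose S1 := \sum_(f in injs N C | a \in codom f) F' f.
pose n1 : R := \sum_(f in injs N C | a \in codom f) 1.
pose S := \sum_(f in injs N C) F' f.
have n1E : #|C|%:R * n1 = N%:R * J.
  have := @sum_tperm_codom C a (fun _ => 1) aC.
  by rewrite sumr_const -/n1 -[n1 *+ _]mulr_natl => ->; rewrite sumr_const.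
have S1le : #|C|%:R * S1 <= e2 * (N%:R * S) + d2 * (N%:R * J).
  rewrite -(sum_tperm_codom F' aC) -n1E.
  have -> : d2 * (#|C|%:R * n1) = \sum_(b in C) d2 * n1.
    by rewrite sumr_const -[RHS]mulr_natl mulrCA.
  have -> : #|C|%:R * S1 = \sum_(b in C) S1 by rewrite sumr_const mulr_natl.
  rewrite mulr_sumr -big_split /=; apply: ler_sum => b bC.
  rewrite /S1 /n1 !mulr_sumr -big_split /=; apply: ler_sum => f /andP[fI _].
  by rewrite mulr1 H3.
have step : \sum_(f in injs N C) F f <= S + (e - 1) * S1 + d * n1.
  rewrite /S (bigID (fun f => a \in codom f)) /= [X in _ <= X + _ + _](bigID (fun f => a \in codom f)) /=.
  rewrite -/S1 [X in _ + X <= _](eq_bigr F'); last by move=> f /andP[fI /H1 ->].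
  have : \sum_(f in injs N C | a \in codom f) F f <= e * S1 + d * n1.
    rewrite /S1 /n1 !mulr_sumr -big_split /=; apply: ler_sum => f /andP[fI _].
    by rewrite mulr1 H2.
  lra.
have S1le' : S1 <= q * (e2 * S + d2 * J).
  rewrite -(ler_pM2l K0); apply: (le_trans S1le); rewrite qE le_eqVlt.
  by apply/orP; left; apply/eqP; field; rewrite gt_eqF.
have n1E' : n1 = q * J.
  by apply: (mulfI (lt0r_neq0 K0)); rewrite n1E qE; field; rewrite gt_eqF.
have e10 : 0 <= e - 1 by lra.
have : \sum_(f in injs N C) F f <= S + (e - 1) * (q * (e2 * S + d2 * J)) + d * (q * J).
  apply: (le_trans step); rewrite n1E' lerD2r lerD2l ler_wpM2l //.
have w0 : 0 <= w by rewrite wE invr_ge0 ltW.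
move=> /(ler_wpM2l w0) /le_trans; apply.
rewrite -/S le_eqVlt; apply/orP; left; apply/eqP.
have wJ : w * J = 1 by rewrite wE mulVf // gt_eqF.
have -> : w * (S + (e - 1) * (q * (e2 * S + d2 * J)) + d * (q * J)) =
  w * S + (e - 1) * (q * (e2 * (w * S) + d2 * (w * J))) + d * (q * (w * J)) by ring.
by rewrite wJ; ring.
Qed.

End amplification.

Section subsampling.
Context (R : realType) (d : measure_display) (Z : measurableType d) (O : finType).
Variables (N n m : nat) (A : rand_alg R Z O N 1).
Implicit Types (U : {set 'I_n}) (x y : n.-tuple (m.-tuple Z)).

Definition cells U : {set 'I_n * 'I_m} := [set a | a.1 \in U]%SET.

Lemma card_cells U : #|cells U| = (#|U| * m)%N.
Proof.
rewrite (_ : cells U = finset.setX U [set: 'I_m]%SET); first by rewrite cardsX cardsT card_ord.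
by apply/setP => -[i j]; rewrite !inE andbT.
Qed.

Definition pick_items (f : {ffun 'I_N -> 'I_n * 'I_m}) (a : 'I_N * 'I_1) := f a.1.

Definition subsample U x (o : O) : R :=
  #|injs N (cells U)|%:R^-1 * \sum_(f in injs N (cells U)) A (sel (pick_items f) x) o.

Lemma subsample_ge0 U x o : 0 <= subsample U x o.
Proof. by rewrite mulr_ge0 // sumr_ge0 // => f _; exact: prob_ge0. Qed.

Lemma subsample_sum1 U x : (N <= #|U| * m)%N -> \sum_o subsample U x o = 1.
Proof.
move=> NU; rewrite -mulr_sumr exchange_big /=.
under eq_bigr => f _ do rewrite prob_sum1.
by rewrite sumr_const mulVf // pnatr_eq0 -lt0n card_injs_gt0 // card_cells.
Qed.

Lemma measurable_subsample U o : measurable_fun setT (fun x => subsample U x o).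
Proof.
apply: measurable_funM => //.
rewrite (_ : (fun x => _) = (fun x => \sum_f
    if f \in injs N (cells U) then A (sel (pick_items f) x) o else 0)); last first.
  by apply/funext => x; rewrite big_mkcond.
apply: measurable_sum => f; case: (f \in injs N (cells U)) => //.
exact: (measurableT_comp (prob_measurable A o) (measurable_sel (pick_items f))).
Qed.

Lemma tnth_sel f x i j : tnth (tnth (sel (pick_items f) x) i) j = item x (f i).
Proof. by rewrite !tnth_mktuple. Qed.

Lemma subsample_local U x y : {in cells U, item x =1 item y} -> subsample U x = subsample U y.
Proof.
move=> xy; apply/funext => o; congr (_ * _); apply: eq_bigr => f /injsP[fC _].
by congr (A _ o); apply: eq_from_item => a; rewrite !item_sel xy // fC.
Qed.

(** A uniform injective selection is invariant under relabelling the cells, so changing the set of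
    users amounts to permuting the data. *)
Lemma subsample_swap (s : 'I_n * 'I_m -> 'I_n * 'I_m) U U' x : involutive s ->
  (forall a, (s a \in cells U') = (a \in cells U)) ->
  subsample U' x = subsample U (sel s x).
Proof.
move=> sK sU; apply/funext => o; rewrite /subsample.
have e F := @sum_postcomp _ N R s (cells U) (cells U') F sK sU.
have := e (fun=> 1); rewrite !sumr_const => ->; rewrite e; congr (_ * _).
apply: eq_bigr => f _; congr (A _ o); apply: eq_from_item => a.
by rewrite !item_sel /pick_items ffunE.
Qed.

Lemma sum_subsample U x (T : {set O}) : \sum_(o in T) subsample U x o =
  #|injs N (cells U)|%:R^-1 * \sum_(f in injs N (cells U)) prob_in A (sel (pick_items f) x) T.
Proof. by rewrite -mulr_sumr exchange_big. Qed.

Variables eps delta : R.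
Hypothesis A_dp : user_level_DP eps delta A.
Hypothesis eps_bnd : 0 <= eps <= 4^-1.
Hypothesis delta_ge0 : 0 <= delta.

(** Group privacy through the hybrid [w], which takes one of the at most two differing entries from
    [z]. *)
Lemma prob_in_group2 (y z : N.-tuple (1.-tuple Z)) (D : {set 'I_N}) (T : {set O}) :
  (#|D| <= 2)%N -> (forall i, i \notin D -> tnth y i = tnth z i) ->
  prob_in A y T <= expR eps ^+ 2 * prob_in A z T + 2 * expR eps * delta.
Proof.
move=> D2 yz; case/andP: eps_bnd => e0 _.
have e1 : 1 <= expR eps by rewrite -expR0 ler_expR.
have pz : 0 <= prob_in A z T by apply: sumr_ge0 => o _; exact: prob_ge0.
have ed : delta <= expR eps * delta by rewrite ler_peMl.
have [i1 i1D|D0] := pickP (mem D); last first.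
  have -> : y = z by apply: eq_from_tnth => i; apply: yz; have /= -> := D0 i.
  have pp : prob_in A z T <= expR eps ^+ 2 * prob_in A z T by rewrite ler_peMl // exprn_ege1.
  by apply: (le_trans pp); rewrite lerDl !mulr_ge0 ?expR_ge0.
pose w := [tuple if i == i1 then tnth z i else tnth y i | i < N].
have yw : prob_in A y T <= expR eps * prob_in A w T + delta.
  apply: A_dp; exists i1 => j ji; by rewrite tnth_mktuple (negbTE ji).
have wz : prob_in A w T <= expR eps * prob_in A z T + delta.
  have [i2 i2D|D1] := pickP (mem (D :\ i1)%SET).
    apply: A_dp; exists i2 => j ji; rewrite tnth_mktuple.
    case: eqP => // /eqP ji1; apply: yz; apply/negP => jD.
    have : (#|[set i1; i2; j]%SET| <= #|D|)%N.
      apply: subset_leq_card; apply/fintype.subsetP => i; rewrite !inE -orbA.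
      move: i2D; rewrite /= !inE => /andP[_ i2D].
      by case/or3P => /eqP ->.
    move: i2D; rewrite /= !inE => /andP[i21 _].
    rewrite finset.setUC cardsU1 cards2 !inE negb_or ji1 ji (eq_sym i1) i21 /= => h.
    by move: (leq_trans h D2).
  apply: A_dp; exists i1 => j ji; rewrite tnth_mktuple (negbTE ji).
  by apply: yz; have := D1 j; rewrite /= !inE ji /= => ->.
apply: (le_trans yw); have := ler_wpM2l (expR_ge0 eps) wz; rewrite expr2; lra.
Qed.

(** An instance of [amplification]: exchanging [a] and [b] inside a selection alters at most two
    sampled entries, so [prob_in_group2] applies. In the first parameter, 4 is the product of the
    constants in [expR eps - 1 <= 2 * eps] and [expR eps ^+ 2 <= 2]. *)
Lemma subsample_indist U x y (a : 'I_n * 'I_m) (q : R) : (N <= #|U| * m)%N ->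
  N%:R / (#|U| * m)%:R <= q ->
  {in cells U, forall b, b != a -> item x b = item y b} ->
  indist (4 * (eps * q)) (4 * (delta * q)) (subsample U x) (subsample U y).
Proof.
move=> NU Nq xy; have d0 := delta_ge0; case/andP: eps_bnd => e0 e14.
have q0 : 0 <= q by apply: le_trans Nq; rewrite divr_ge0.
have [aU|aU] := boolP (a \in cells U); last first.
  rewrite (@subsample_local U x y); last first.
    by move=> b bU; apply: xy => //; apply: contraNneq aU => <-.
  by apply: indist_refl; rewrite ?mulr_ge0 // => o; exact: subsample_ge0.
have e1 : 1 <= expR eps by rewrite -expR0 ler_expR.
have e2 : expR eps <= 1 + 2 * eps by apply: expR_le1D2; rewrite e0; lra.
apply/indistP => T; rewrite !sum_subsample.
have H1 f : f \in injs N (cells U) -> a \notin codom f ->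
    prob_in A (sel (pick_items f) x) T = prob_in A (sel (pick_items f) y) T.
  move=> /injsP[fC _] af; congr (prob_in A _ T); apply: eq_from_item => -[i j].
  rewrite !item_sel /pick_items /= xy //; apply: contraNneq af => <-; exact: codom_f.
have H2 f : f \in injs N (cells U) ->
    prob_in A (sel (pick_items f) x) T <=
    expR eps * prob_in A (sel (pick_items f) y) T + delta.
  move=> fI; have [/codomP[i fi]|af] := boolP (a \in codom f); last first.
    rewrite H1 //.
    have : 0 <= prob_in A (sel (pick_items f) y) T.
      by apply: sumr_ge0 => o _; exact: prob_ge0.
    by move=> p0; have := ler_wpM2r p0 e1; lra.
  case/injsP: fI => fC finj.
  apply: A_dp; exists i => j ji; apply: eq_from_tnth => l.
  by rewrite !tnth_sel xy // fi (inj_eq finj).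
have H3 f b : f \in injs N (cells U) -> b \in cells U ->
    prob_in A (sel (pick_items f) y) T <=
    expR eps ^+ 2 * prob_in A (sel (pick_items (postcomp (tperm a b) f)) y) T
      + 2 * expR eps * delta.
  case/injsP => fC finj bU.
  apply: (@prob_in_group2 _ _ [set i | f i \in [set a; b]%SET]%SET).
    rewrite -(card_imset _ finj); apply: leq_trans (_ : #|[set a; b]%SET| <= 2)%N.
      apply: subset_leq_card; apply/fintype.subsetP => c /imsetP[i]; by rewrite inE => h ->.
    by rewrite cards2; case: (a != b).
  move=> i; rewrite !inE negb_or => /andP[fa fb]; apply: eq_from_tnth => l.
  by rewrite !tnth_sel ffunE tpermD // eq_sym.
have NC : (N <= #|cells U|)%N by rewrite card_cells.
have := @amplification R _ N (cells U) a _ _ _ _ _ _ aU NC e1 H1 H2 H3 _ _ erefl erefl.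
rewrite /= card_cells; move/le_trans; apply.
set w := _^-1 * _; have w0 : 0 <= w.
  by rewrite mulr_ge0 // sumr_ge0 // => f _; apply: sumr_ge0 => o _; exact: prob_ge0.
set p := N%:R / _ in Nq *; have p0 : 0 <= p by rewrite divr_ge0.
have e32 : expR eps <= 3 / 2 by lra.
have E0 : 0 <= expR eps - 1 by lra.
have esq : expR eps ^+ 2 <= 2.
  rewrite expr2; have -> : expR eps * expR eps = expR (2 * eps) by rewrite -expRD; congr expR; ring.
  by apply: (le_trans (expR_le1D2 _)); rewrite ?mulr_ge0 /=; lra.
apply: lerD.
  rewrite ler_wpM2r //; apply: le_trans (expR_ge1Dx _); rewrite lerD2l.
  have h : (expR eps - 1) * expR eps ^+ 2 <= 4 * eps.
    have := ler_wpM2l E0 esq; lra.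
  apply: (@le_trans _ _ (4 * eps * p)); first by rewrite ler_wpM2r.
  by rewrite -!mulrA ler_pM2l // ler_wpM2l.
have h : (expR eps - 1) * (2 * expR eps * delta) + delta <= 4 * delta.
  have h1 : (expR eps - 1) * (2 * expR eps) <= 2^-1 * 3.
    apply: ler_pM; rewrite ?mulr_ge0 //; lra.
  have := ler_wpM2r delta_ge0 h1; lra.
apply: (@le_trans _ _ (4 * delta * p)); first by rewrite ler_wpM2r.
by rewrite -!mulrA ler_pM2l // ler_wpM2l.
Qed.

End subsampling.

(** * Release from a stable set *)

Section finite_sets.
Context (T : finType).
Implicit Types A B C : {set T}.

Lemma ex_subset_card A k : (k <= #|A|)%N -> exists2 B : {set T}, B \subset A & #|B| = k.
Proof.
move=> kA; exists [set x in take k (enum A)]%SET.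
  by apply/fintype.subsetP => x; rewrite inE => /mem_take; rewrite mem_enum.
rewrite cardsE (card_uniqP _) ?take_uniq ?enum_uniq // size_take -cardE.
by case: ltngtP kA => // ->.
Qed.

Lemma ex_superset_card A k : (#|A| <= k <= #|T|)%N -> exists2 B : {set T}, A \subset B & #|B| = k.
Proof.
move=> /andP[Ak kT].
have [|C CA cC] := @ex_subset_card (~: A)%SET (k - #|A|)%N.
  by have := cardsC A; lia.
exists (A :|: C)%SET; first exact: finset.subsetUl.
rewrite cardsU (_ : (A :&: C)%SET = finset.set0) ?cards0 ?cC; first by lia.
apply/setP => x; rewrite !inE; apply/negP => /andP[xA /(fintype.subsetP CA)].
by rewrite inE xA.
Qed.

Lemma avoidW A B C : (B \subset C -> A \subset ~: C -> A \subset ~: B)%SET.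
Proof. by move=> BC /fintype.subset_trans; apply; rewrite finset.setCS. Qed.

End finite_sets.

Section release_probability.
Context (R : realType).
Variables (kappa : nat) (eps delta : R).
Hypothesis eps_ge0 : 0 <= eps.
Hypothesis kappa_large : 2 * expR (- (eps * (kappa%:R / 2))) <= delta.
Hypothesis delta_small : delta <= 1.
Hypothesis expR_eps : expR eps <= 2.

Definition odds (r : nat) : R := expR (eps * (r%:R - kappa%:R / 2)).

(** A logistic curve centred at [kappa / 2], for which the probability and its complement both
    change by at most a factor [expR eps] per step. It is forced to 1 at 0, so that stable inputs
    lose no utility, and to 0 beyond [kappa], where no witness exists; [kappa_large] makes both
    jumps negligible. *)
Definition release (r : nat) : R :=
  if r == 0 then 1 else if (r <= kappa)%N then (1 + odds r)^-1 else 0.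

Lemma release0 : release 0 = 1. Proof. by []. Qed.

Lemma release_gt r : (kappa < r)%N -> release r = 0.
Proof. by case: r => // r kr; rewrite /release /= leqNgt kr. Qed.

Let odds_gt0 r : 0 < odds r. Proof. exact: expR_gt0. Qed.

Let oddsS r : odds r.+1 = expR eps * odds r.
Proof. by rewrite -expRD; congr expR; rewrite -natr1; ring. Qed.

Let le1e : 1 <= expR eps. Proof. by rewrite -expR0 ler_expR. Qed.

Let inv_odds_lt1 r : 0 < (1 + odds r)^-1 <= 1.
Proof. by rewrite invr_gt0 invf_le1 ?lerDl ?addr_gt0 // ltW. Qed.

Lemma release_bnd r : 0 <= release r <= 1.
Proof.
rewrite /release; case: eqP => _; first by rewrite ler01 lexx.
case: ifP => _; last by rewrite lexx ler01.
by have /andP[/ltW -> ->] := inv_odds_lt1 r.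
Qed.

Let odds0 : 2 * odds 0 <= delta.
Proof. by rewrite /odds sub0r mulrN. Qed.

Let oddsK : 2 * (odds kappa)^-1 <= delta.
Proof. by rewrite /odds -expRN; apply: le_trans kappa_large; rewrite ler_pM2l // ler_expR; lra. Qed.

Let kappa_gt0 : (0 < kappa)%N.
Proof.
rewrite lt0n; apply/eqP => k0.
have := le_trans kappa_large delta_small; rewrite k0 mul0r mulr0 oppr0 expR0; lra.
Qed.

Let inv_step r : (1 + odds r)^-1 <= expR eps * (1 + odds r.+1)^-1.
Proof.
have a0 : 0 < 1 + odds r by rewrite addr_gt0.
have b0 : 0 < 1 + odds r.+1 by rewrite addr_gt0.
rewrite ler_pdivlMr // mulrC ler_pdivrMr // oddsS; have := le1e; lra.
Qed.

Let compl_step r : 1 - (1 + odds r.+1)^-1 <= expR eps * (1 - (1 + odds r)^-1).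
Proof.
have a0 : 0 < 1 + odds r by rewrite addr_gt0.
have b0 : 0 < 1 + odds r.+1 by rewrite addr_gt0.
have compl s : 0 < 1 + odds s -> 1 - (1 + odds s)^-1 = odds s / (1 + odds s).
  by move=> s0; field; rewrite gt_eqF.
rewrite !compl // mulrA -oddsS ler_pM2l // lef_pV2 ?posrE // lerD2l oddsS.
by rewrite ler_peMl // ltW.
Qed.

Let inv_mono r : (1 + odds r.+1)^-1 <= (1 + odds r)^-1.
Proof.
by rewrite lef_pV2 ?posrE ?addr_gt0 // lerD2l oddsS ler_peMl // ltW.
Qed.

Let inv0 : 1 - (1 + odds 0)^-1 <= odds 0.
Proof.
have a0 : 0 < 1 + odds 0 by rewrite addr_gt0.
have -> : 1 - (1 + odds 0)^-1 = odds 0 / (1 + odds 0) by field; rewrite gt_eqF.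
by rewrite ler_pdivrMr // ler_peMr // ?lerDl ltW.
Qed.

Lemma release_step r : [/\ release r.+1 <= release r,
  release r <= expR eps * release r.+1 + delta &
  1 - release r.+1 <= expR eps * (1 - release r) + delta].
Proof.
have d0 : 0 <= delta by apply: le_trans odds0; rewrite mulr_ge0 // ltW.
have e2 := expR_eps; have e1 := le1e.
case: r => [|r].
  rewrite /release /= kappa_gt0.
  have := inv_step 0; have := compl_step 0; have := inv0; have := odds0.
  have /andP[_ i1] := inv_odds_lt1 1; have /andP[_ i0] := inv_odds_lt1 0.
  move=> o h c s; split; [by []|lra|].
  (* At 0 the complement is exactly zero, so the whole complement at 1 must fit into [delta]. It is
     at most [2 * odds 0], which explains the factor 2 in [kappa_large]. *)
  rewrite subrr mulr0 add0r; apply: (le_trans c).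
  have : expR eps * (1 - (1 + odds 0)^-1) <= 2 * (1 - (1 + odds 0)^-1).
    by rewrite ler_wpM2r // subr_ge0.
  lra.
rewrite /release /=; have [rk|rk] := ltnP r kappa; last first.
  by rewrite leqNgt (leq_ltn_trans rk) //= !subr0 mulr0 add0r mulr1 d0; split => //; lra.
have /andP[i0 i1] := inv_odds_lt1 r.+1.
have [rk'|rk'] := ltnP r.+1 kappa.
  split; first exact: inv_mono.
    by have := inv_step r.+1; lra.
  by have := compl_step r.+1; lra.
have rE : r.+1 = kappa by apply/anti_leq; rewrite rk rk'.
have small : (1 + odds r.+1)^-1 <= delta / 2.
  rewrite rE; apply: (@le_trans _ _ (odds kappa)^-1); last by have := oddsK; lra.
  by rewrite lef_pV2 ?posrE ?addr_gt0 // lerDr.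
split; first exact: ltW.
  by rewrite mulr0 add0r; lra.
have : 1 * (1 - (1 + odds r.+1)^-1) <= expR eps * (1 - (1 + odds r.+1)^-1).
  by rewrite ler_wpM2r // subr_ge0.
lra.
Qed.

Lemma release_adjacent r s : (r <= s.+1)%N -> (s <= r.+1)%N ->
  release r <= expR eps * release s + delta /\
  1 - release r <= expR eps * (1 - release s) + delta.
Proof.
move=> rs sr.
have d0 : 0 <= delta by apply: le_trans odds0; rewrite mulr_ge0 // ltW.
have scale x : 0 <= x -> x <= expR eps * x by move=> x0; rewrite ler_peMl.
have pos_r t : 0 <= release t /\ 0 <= 1 - release t.
  by have /andP[? ?] := release_bnd t; rewrite subr_ge0.
have [/eqP->|/eqP->|/eqP->] : [\/ r == s, r == s.+1 | s == r.+1].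
  by have [] := ltngtP r s => h; [constructor 3|constructor 2|constructor 1]; rewrite ?h //; lia.
- by have [a b] := pos_r s; have := scale _ a; have := scale _ b; lra.
- have [a b] := pos_r s; have [m1 m2 m3] := release_step s.
  by have := scale _ a; split; lra.
- have [a b] := pos_r r.+1; have [m1 m2 m3] := release_step r.
  by have := scale _ b; split; lra.
Qed.

End release_probability.

(** The factors [e] for the weights and [e * e] for the first component multiply. The constant 8
    collects 1 from the [Q] part, at most 3 from [e * d + d], and 4 from [d * (e * e * Py)]. *)
Lemma mixture_bound (R : realType) (e d px py Px Py Q : R) :
  1 <= e <= 2 -> 0 <= d -> 0 <= px <= 1 -> 0 <= py <= 1 -> 0 <= Px <= 1 -> 0 <= Py <= 1 ->
  0 <= Q <= 1 -> px <= e * py + d -> 1 - px <= e * (1 - py) + d ->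
  Px <= e * e * Py + (e * d + d) ->
  px * Px + (1 - px) * Q <= e * (e * e) * (py * Py + (1 - py) * Q) + 8 * d.
Proof.
move=> /andP[e1 e2] d0 /andP[px0 px1] /andP[py0 py1] /andP[Px0 Px1] /andP[Py0 Py1].
move=> /andP[Q0 Q1] A B PxPy.
have e0 : 0 <= e by lra.
have e4 : e * e <= 4 by have : e * e <= 2 * 2 by [apply: ler_pM]; lra.
have e3 : e <= e * (e * e) by rewrite ler_peMr // mulr_ege1.
have Qpart : (1 - px) * Q <= e * (e * e) * ((1 - py) * Q) + d.
  apply: (le_trans (ler_wpM2r Q0 B)); rewrite mulrDl; apply: lerD.
    by rewrite -[leLHS]mulrA ler_wpM2r // mulr_ge0 // subr_ge0.
  by rewrite ler_piMr.
have h1 : px * Px <= px * (e * e * Py + (e * d + d)) by rewrite ler_wpM2l.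
have h2 : px * (e * e * Py) <= (e * py + d) * (e * e * Py) by rewrite ler_wpM2r // !mulr_ge0.
have h3 : px * (e * d + d) <= e * d + d by rewrite ler_piMl // addr_ge0 // mulr_ge0.
have h4 : e * d <= 2 * d by rewrite ler_wpM2r.
have h5 : d * (e * e * Py) <= d * 4.
  by rewrite ler_wpM2l // -[leRHS]mulr1 ler_pM // mulr_ge0.
lra.
Qed.

Section stable_release.
Context (R : realType) (O : finType) (Y : Type).
Variables (n u kappa : nat) (P : {set 'I_n} -> n.-tuple Y -> O -> R) (eps delta : R).
Hypothesis P_ge0 : forall U x o, 0 <= P U x o.
Hypothesis P_sum1 : forall (U : {set 'I_n}) x, #|U| = u -> \sum_o P U x o = 1.
Hypothesis P_local : forall (U : {set 'I_n}) x y,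
  (forall i, i \in U -> tnth x i = tnth y i) -> P U x = P U y.
Hypothesis n_large : (u + (2 * kappa + 1) <= n)%N.
Implicit Types (x y : n.-tuple Y) (S U : {set 'I_n}) (sg : {set {set 'I_n}}).

Definition stable_at x S U U' :=
  [&& #|U| == u, #|U'| == u, (U \subset ~: S)%SET & (U' \subset ~: S)%SET] ==>
  indist eps delta (P U x) (P U' x).

Definition stable x S := [forall U, forall U', stable_at x S U U'].

Lemma stableP x S : reflect (forall U U', #|U| = u -> #|U'| = u ->
    (U \subset ~: S)%SET -> (U' \subset ~: S)%SET -> indist eps delta (P U x) (P U' x)) (stable x S).
Proof.
apply: (iffP forallP) => [H U U' /eqP cU /eqP cU' dU dU'|H U].
  by have /forallP/(_ U')/implyP := H U; apply; rewrite cU cU' dU dU'.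
apply/forallP => U'; apply/implyP => /and4P[/eqP cU /eqP cU' dU dU']; exact: H.
Qed.

(** Radius and witness depend on the input only through this statistic with finitely many values,
    which reduces measurability to finitely many cases. *)
Definition signature x : {set {set 'I_n}} := [set S | stable x S]%SET.

Definition has_size sg r := [exists S : {set 'I_n}, (S \in sg) && (#|S| == r)].

(* Equal to [kappa.+1] when no member of [sg] has at most [kappa] elements. *)
Definition stab_radius sg : nat := find (has_size sg) (iota 0 kappa.+1).

(** A least stable set can be enlarged to exactly [kappa] users, so this size can be imposed. When
    the radius is at most [kappa] a witness exists, hence the default only ever appears with release
    weight 0. *)
Definition witness sg : {set 'I_n} := odflt finset.set0
  [pick U : {set 'I_n} | (#|U| == u) &&
     [exists S : {set 'I_n}, [&& S \in sg, #|S| == kappa & (U \subset ~: S)%SET]]].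

Definition stable_release x (o : O) : R :=
  let sg := signature x in
  release kappa eps (stab_radius sg) * P (witness sg) x o +
  (1 - release kappa eps (stab_radius sg)) * #|O|%:R^-1.

Lemma stable_sub x S S' : S \subset S' -> stable x S -> stable x S'.
Proof.
move=> SS /stableP H; apply/stableP => U U' cU cU' dU dU'.
by apply: H => //; [apply: avoidW dU|apply: avoidW dU'].
Qed.

(** Sets of users avoiding [i] never read the changed data. *)
Lemma stable_neighbor x y i S : (forall j, j != i -> tnth x j = tnth y j) ->
  stable x S -> stable y (i |: S)%SET.
Proof.
move=> xy /stableP H; apply/stableP => U U' cU cU' dU dU'.
have loc (V : {set 'I_n}) : (V \subset ~: (i |: S))%SET -> P V y = P V x.
  move=> dV; apply: P_local => j jV; rewrite xy //.
  by apply: contraTneq (fintype.subsetP dV _ jV) => ->; rewrite !inE eqxx.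
by rewrite !loc //; apply: H => //; [apply: avoidW dU|apply: avoidW dU']; exact: finset.subsetUr.
Qed.

Lemma stab_radius_bnd sg : (stab_radius sg <= kappa.+1)%N.
Proof. by rewrite -[leqRHS](size_iota 0) find_size. Qed.

Lemma stab_radius_le sg S : S \in sg -> (stab_radius sg <= #|S|)%N.
Proof.
move=> Ss; have [Sk|Sk] := leqP #|S| kappa; last exact: leq_trans (stab_radius_bnd sg) Sk.
rewrite leqNgt; apply/negP => /(before_find 0).
by rewrite nth_iota // add0n => /negbT/existsPn/(_ S); rewrite Ss eqxx.
Qed.

Lemma stab_radius_ex sg : (stab_radius sg <= kappa)%N -> exists2 S, S \in sg & #|S| = stab_radius sg.
Proof.
rewrite -ltnS -[ltnRHS](size_iota 0) -has_find => h.
have := nth_find 0 h; rewrite nth_iota ?add0n; last first.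
  by rewrite -[ltnRHS](size_iota 0) -has_find.
by case/existsP => S /andP[Ss /eqP cS]; exists S.
Qed.

Lemma stab_radius_setT : stab_radius [set: {set 'I_n}]%SET = 0%N.
Proof. by apply/eqP; rewrite -leqn0 -(cards0 'I_n) stab_radius_le ?inE. Qed.

Lemma witnessP x : (stab_radius (signature x) <= kappa)%N ->
  exists S, [/\ stable x S, #|S| = kappa, #|witness (signature x)| = u &
                (witness (signature x) \subset ~: S)%SET].
Proof.
move=> /[dup] rk /stab_radius_ex[S0]; rewrite inE => st0 cS0.
have [|S S0S cS] := @ex_superset_card _ S0 kappa.
  by rewrite cS0 rk card_ord; move: n_large; lia.
have st : stable x S by exact: stable_sub st0.
have [|U US cU] := @ex_subset_card _ (~: S)%SET u.
  by have := cardsC S; rewrite card_ord cS; move: n_large; lia.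
rewrite /witness; case: pickP => /= [V /andP[/eqP cV /existsP[S' /and3P[]]]|/(_ U)].
  by rewrite inE => st' /eqP cS' dV; exists S'.
by rewrite cU eqxx /= => /negbT/existsPn/(_ S); rewrite inE st cS eqxx US.
Qed.

(** Two stable sets of size [kappa] and the changed user exclude at most [2 * kappa + 1] users, so
    [n_large] leaves room for a common [V] of size [u]. Both witnesses are compared with [V], on
    which the inputs agree. *)
Lemma witness_indist x y i : (forall j, j != i -> tnth x j = tnth y j) ->
  (stab_radius (signature x) <= kappa)%N -> (stab_radius (signature y) <= kappa)%N ->
  indist (eps + eps) (expR eps * delta + delta)
    (P (witness (signature x)) x) (P (witness (signature y)) y).
Proof.
move=> xy /witnessP[S [st cS cU dU]] /witnessP[S' [st' cS' cU' dU']].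
have [|V dV cV] := @ex_subset_card _ (~: (i |: (S :|: S')))%SET u.
  have := cardsC (i |: (S :|: S'))%SET; rewrite card_ord cardsU1 cardsU cS cS'.
  by move: n_large; case: (i \notin _) => /=; lia.
have PV : P V x = P V y.
  apply: P_local => j jV; apply: xy.
  by apply: contraTneq (fintype.subsetP dV _ jV) => ->; rewrite !inE eqxx.
apply: (@indist_trans _ _ _ _ _ _ _ (P V x)); last first.
  rewrite PV; move/stableP: st'; apply => //; apply: avoidW dV.
  by apply/fintype.subsetP => j; rewrite !inE => ->; rewrite !orbT.
move/stableP: st; apply => //; apply: avoidW dV.
by apply/fintype.subsetP => j; rewrite !inE => ->; rewrite !orbT.
Qed.

Lemma stab_radius_neighbor x y i : (forall j, j != i -> tnth x j = tnth y j) ->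
  (stab_radius (signature y) <= (stab_radius (signature x)).+1)%N.
Proof.
move=> xy; have [rk|rk] := leqP (stab_radius (signature x)) kappa; last first.
  exact: leq_trans (stab_radius_bnd _) (leqW rk).
have [S] := stab_radius_ex rk; rewrite inE => st <-.
have := @stab_radius_le (signature y) (i |: S)%SET; rewrite inE => /(_ (stable_neighbor xy st)).
by move=> /leq_trans; apply; rewrite cardsU1; case: (i \notin S).
Qed.

Hypothesis eps_ge0 : 0 <= eps.
Hypothesis expR_eps : expR eps <= 2.
Hypothesis delta_small : delta <= 1.
Hypothesis kappa_large : 2 * expR (- (eps * (kappa%:R / 2))) <= delta.

Lemma stable_release_ge0 x o : 0 <= stable_release x o.
Proof.
have /andP[r0 r1] := release_bnd kappa eps (stab_radius (signature x)).
by rewrite addr_ge0 ?mulr_ge0 ?subr_ge0 ?invr_ge0.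
Qed.

Lemma stable_release_sum1 x : (0 < #|O|)%N -> \sum_o stable_release x o = 1.
Proof.
move=> O0; rewrite big_split /= -mulr_sumr sumr_const.
have -> : ((1 - release kappa eps (stab_radius (signature x))) / #|O|%:R) *+ #|O| =
    1 - release kappa eps (stab_radius (signature x)).
  by rewrite -mulr_natr divfK // pnatr_eq0 -lt0n.
have [rk|rk] := leqP (stab_radius (signature x)) kappa.
  by have [S [_ _ cU _]] := witnessP rk; rewrite P_sum1 //; ring.
by rewrite release_gt // mul0r; ring.
Qed.

(** Beyond radius [kappa] the release weight is 0, so any value [c] may stand for the mass there.
    The privacy proof takes the extreme value that makes the comparison trivial. *)
Definition witness_mass x (T : {set O}) (c : R) : R :=
  if (stab_radius (signature x) <= kappa)%N
  then \sum_(o in T) P (witness (signature x)) x o else c.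

Lemma sum_stable_release x (T : {set O}) c : \sum_(o in T) stable_release x o =
  release kappa eps (stab_radius (signature x)) * witness_mass x T c +
  (1 - release kappa eps (stab_radius (signature x))) * (#|T|%:R / #|O|%:R).
Proof.
rewrite /stable_release big_split /= -mulr_sumr -mulr_sumr sumr_const mulr_natl.
by congr (_ + _); rewrite /witness_mass; case: leqP => // h; rewrite release_gt // !mul0r.
Qed.

Lemma witness_mass_bnd x (T : {set O}) c : 0 <= c <= 1 -> 0 <= witness_mass x T c <= 1.
Proof.
rewrite /witness_mass; case: leqP => // rk _; rewrite sumr_ge0 //=.
have [S [_ _ cU _]] := witnessP rk.
by rewrite -(P_sum1 x cU) [leRHS](bigID (mem T)) /= lerDl sumr_ge0.
Qed.

(** Radii of neighbours differ by at most one, so the weights cost [eps]; the witnesses cost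
    [2 * eps]. [mixture_bound] combines the two. *)
Lemma stable_release_private x y i (T : {set O}) :
  (0 < #|O|)%N -> (forall j, j != i -> tnth x j = tnth y j) ->
  \sum_(o in T) stable_release x o <=
  expR (3 * eps) * (\sum_(o in T) stable_release y o) + 8 * delta.
Proof.
move=> O0 xy.
have yx j : j != i -> tnth y j = tnth x j by move/xy.
have d0 : 0 <= delta by apply: le_trans kappa_large; rewrite mulr_ge0 ?expR_ge0.
have e1 : 1 <= expR eps by rewrite -expR0 ler_expR.
have E3 : expR (3 * eps) = expR eps * (expR eps * expR eps).
  by rewrite -!expRD; congr expR; ring.
rewrite [X in X <= _](sum_stable_release x T 0) [X in _ <= _ * X + _](sum_stable_release y T 1).
rewrite [X in _ <= X * _ + _]E3.
have [A B] := release_adjacent eps_ge0 kappa_large delta_small expR_eps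
  (stab_radius_neighbor yx) (stab_radius_neighbor xy).
apply: mixture_bound A B _.
- by rewrite e1 expR_eps.
- exact: d0.
- exact: release_bnd.
- exact: release_bnd.
- by apply: witness_mass_bnd; rewrite lexx ler01.
- by apply: witness_mass_bnd; rewrite lexx ler01.
- by rewrite divr_ge0 //= ler_pdivrMr ?ltr0n // mul1r ler_nat max_card.
have ed0 : 0 <= expR eps * delta + delta by rewrite addr_ge0 // mulr_ge0 // expR_ge0.
(* If [y] has no witness its mass counts as 1, which dominates; if [x] has none its mass counts as
   0. What remains is the case of two genuine witnesses. *)
have [ry|ry] := leqP (stab_radius (signature y)) kappa; last first.
  have -> : witness_mass y T 1 = 1 by rewrite /witness_mass leqNgt ry.
  have /andP[_ /le_trans] := @witness_mass_bnd x T 0 (introT andP (conj (lexx _) ler01)).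
  by apply; rewrite mulr1 ler_wpDr // mulr_ege1.
have [rx|rx] := leqP (stab_radius (signature x)) kappa; last first.
  have -> : witness_mass x T 0 = 0 by rewrite /witness_mass leqNgt rx.
  rewrite addr_ge0 // mulr_ge0 ?mulr_ge0 ?expR_ge0 //.
  by have /andP[] := @witness_mass_bnd y T 1 (introT andP (conj ler01 (lexx _))).
rewrite /witness_mass rx ry -expRD; have /indistP := witness_indist xy rx ry; exact.
Qed.

End stable_release.

(** * Measurability of the release *)

Section measurable_release.
Context (R : realType) (d : measure_display) (Y : measurableType d) (O : finType).
Variables (n u kappa : nat) (P : {set 'I_n} -> n.-tuple Y -> O -> R) (eps delta : R).
Hypothesis mP : forall U o, measurable_fun setT (fun x => P U x o).

Lemma measurable_forall (I : finType) (B : I -> n.-tuple Y -> bool) :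
  (forall i, measurable [set x | B i x]) -> measurable [set x | [forall i, B i x]].
Proof.
move=> mB; rewrite (_ : [set x | _] = \bigcap_(i in setT) [set x | B i x]).
  exact: fin_bigcap_measurable.
by apply/seteqP; split => x /=; [move=> /forallP Bx i _; exact: Bx|move=> Bx; apply/forallP => i; exact: Bx].
Qed.

Lemma measurable_indist U U' : measurable [set x | indist eps delta (P U x) (P U' x)].
Proof.
apply: measurable_forall => T.
pose f x := expR eps * (\sum_(o in T) P U' x o) + delta - \sum_(o in T) P U x o.
have mS V : measurable_fun setT (fun x => \sum_(o in T) P V x o).
  rewrite (_ : (fun x => _) = (fun x => \sum_o if o \in T then P V x o else 0)).
    by apply: measurable_sum => o; case: (o \in T).
  by apply/funext => x; rewrite big_mkcond.
have mf : measurable_fun setT f.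
  by apply: measurable_funB => //; apply: measurable_funD => //; apply: measurable_funM.
rewrite (_ : [set x | _] = setT `&` f @^-1` `[0, +oo[%classic); first exact: mf.
by rewrite setTI; apply/seteqP; split => x /=; rewrite in_itv /= andbT /f subr_ge0.
Qed.

Lemma measurable_stable S : measurable [set x | stable u P eps delta x S].
Proof.
apply: measurable_forall => U; apply: measurable_forall => U'; rewrite /stable_at.
case: [&& _, _, _ & _] => /=; first exact: measurable_indist.
by rewrite (_ : [set x | _] = setT) //; apply/seteqP; split.
Qed.

Lemma measurable_signature sg : measurable [set x | signature u P eps delta x == sg].
Proof.
rewrite (_ : [set x | _] = [set x | [forall S, stable u P eps delta x S == (S \in sg)]]).
  apply: measurable_forall => S; case: (S \in sg).
    by rewrite (_ : [set x | _] = [set x | stable u P eps delta x S]);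
      [exact: measurable_stable|apply/seteqP; split => x /=; rewrite eqb_id].
  rewrite (_ : [set x | _] = ~` [set x | stable u P eps delta x S]).
    by apply: measurableC; exact: measurable_stable.
  by apply/seteqP; split => x /=; rewrite eqbF_neg => /negP.
apply/seteqP; split => x /=; first by move=> /eqP <-; apply/forallP => S; rewrite inE.
by move=> /forallP H; apply/eqP/setP => S; rewrite inE; have /eqP := H S.
Qed.

(** With the signature fixed, the weight and the witness are constants; the release is a finite sum
    over signatures, cut off by indicators. *)
Lemma measurable_stable_release o :
  measurable_fun setT (fun x => stable_release u kappa P eps delta x o).
Proof.
pose body sg x := release kappa eps (stab_radius kappa sg) * P (witness u kappa sg) x o +
  (1 - release kappa eps (stab_radius kappa sg)) * #|O|%:R^-1.
rewrite (_ : (fun x => _) = (fun x => \sum_sg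
    \1_[set x | signature u P eps delta x == sg] x * body sg x)).
  apply: measurable_sum => sg; apply: measurable_funM.
    by apply: measurable_indic; exact: measurable_signature.
  by apply: measurable_funD => //; apply: measurable_funM.
apply/funext => x; rewrite (bigD1 (signature u P eps delta x)) //= big1 => [|sg ne].
  by rewrite addr0 indicE mem_set /= ?eqxx // mul1r.
by rewrite indicE memNset ?mul0r //= eq_sym; exact/negP.
Qed.

End measurable_release.

(** * Integrals of cube averages *)

Section integral_average.
Context (R : realType) (d : measure_display) (X : measurableType d).
Variable mu : probability X R.

Lemma measurable_avg M (f : seq bool -> X -> R) :
  (forall v, measurable_fun setT (f v)) ->
  measurable_fun setT (fun x => avg M (f ^~ x)).
Proof.
elim: M f => [|M IH] f mf /=; first exact: mf.
apply: measurable_funM => //; apply: measurable_funD.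
  exact: (IH (fun v => f (true :: v))).
exact: (IH (fun v => f (false :: v))).
Qed.

Lemma integral_avg M (f : seq bool -> X -> R) (c : \bar R) :
  (forall v, measurable_fun setT (f v)) -> (forall v x, 0 <= f v x) ->
  (forall v, \int[mu]_x (f v x)%:E = c)%E -> (\int[mu]_x (avg M (f ^~ x))%:E = c)%E.
Proof.
elim: M f => [|M IH] f mf f0 fc; first exact: fc.
have IHb b := IH (fun v => f (b :: v)) (fun v => mf _) (fun v => f0 _) (fun v => fc _).
have mb b := @measurable_avg M (fun v => f (b :: v)) (fun v => mf _).
have b0 b x : 0 <= avg M (fun v => f (b :: v) x) by apply: avg_ge0.
have c0 : (0 <= c)%E by rewrite -(fc [::]); apply: integral_ge0 => x _; rewrite lee_fin.
under eq_integral => x _ do rewrite /= mulrC EFinM EFinD.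
have me b : measurable_fun setT (fun x => (avg M (fun v => f (b :: v) x))%:E).
  by apply: measurableT_comp => //; exact: mb.
rewrite ge0_integralZl //; last 2 first.
- exact: emeasurable_funD.
- by move=> x _; rewrite adde_ge0 // lee_fin.
rewrite ge0_integralD //; try by move=> x _; rewrite lee_fin.
rewrite !IHb; case: c c0 {fc IH IHb} => [r||] // _.
  by rewrite -EFinD -EFinM; congr (_%:E); lra.
by rewrite gt0_muley // lte_fin invr_gt0.
Qed.

End integral_average.

(** The two set differences have equal cardinality and are exchanged along their enumerations;
    everything else is fixed. *)
Lemma exchange_involution (T : finType) (A B : {set T}) : #|A| = #|B| ->
  exists rho : T -> T, [/\ involutive rho, forall i, (rho i \in B) = (i \in A) &
    forall i, (i \in A) = (i \in B) -> rho i = i].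
Proof.
move=> AB; set D := (A :\: B)%SET; set D' := (B :\: A)%SET.
have DD : #|D| = #|D'|.
  by have := cardsID B A; have := cardsID A B; rewrite finset.setIC -/D -/D'; lia.
pose to (E F : {set T}) i := nth i (enum F) (index i (enum E)).
have toE (E F : {set T}) i : #|E| = #|F| -> i \in E -> to E F i \in F.
  by move=> EF iE; rewrite -mem_enum mem_nth // -cardE -EF cardE index_mem mem_enum.
have toK (E F : {set T}) i : #|E| = #|F| -> i \in E -> to F E (to E F i) = i.
  move=> EF iE; rewrite /to index_uniq ?enum_uniq //; last first.
    by rewrite -cardE -EF cardE index_mem mem_enum.
  rewrite (set_nth_default i) ?nth_index ?mem_enum //.
  by rewrite index_mem mem_enum.
pose rho i := if i \in D then to D D' i else if i \in D' then to D' D i else i.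
have inD i : (i \in D) = (i \notin B) && (i \in A) by rewrite inE.
have inD' i : (i \in D') = (i \notin A) && (i \in B) by rewrite inE.
have D'D0 i : i \in D' -> (i \in D) = false.
  by rewrite inD inD' => /andP[_ ->].
exists rho; split => [i|i|i].
- rewrite /rho; case: (boolP (i \in D)) => iD.
    have h := toE _ _ _ DD iD; rewrite (D'D0 _ h) h; exact: toK.
  case: (boolP (i \in D')) => iD'; last by rewrite (negbTE iD) (negbTE iD').
  by have h := toE _ _ _ (esym DD) iD'; rewrite h; exact: toK.
- rewrite /rho; case: (boolP (i \in D)) => iD.
    have := toE _ _ _ DD iD; move: iD; rewrite inD inD' => /andP[_ ->].
    by case/andP.
  case: (boolP (i \in D')) => iD'.
    have := toE _ _ _ (esym DD) iD'; move: iD'; rewrite inD inD' => /andP[/negbTE -> _].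
    by case/andP => /negbTE.
  by move: iD iD'; rewrite inD inD'; case: (i \in A); case: (i \in B).
- by rewrite /rho inD inD' => ->; rewrite !andNb.
Qed.

Lemma ham1_nth (v w : seq bool) : size v = size w -> ham v w = 1%N ->
  exists2 p, (p < size v)%N & forall q, q != p -> nth false v q = nth false w q.
Proof.
elim: v w => [|a v IH] [|b w] //= [vw]; case: (eqVneq a b) => [<-|ab] /=.
  by rewrite add0n => /(IH _ vw)[p pv H]; exists p.+1 => // -[|q] //= qp; exact: H.
by rewrite add1n => -[/(ham_eq0 vw) ->]; exists 0%N => // -[|q].
Qed.

(** * Failure probability and utility *)

Section bad_pairs.
Context (R : realType) (d : measure_display) (Z : measurableType d) (O : finType).
Variables (N n m u : nat) (A : rand_alg R Z O N 1) (eps delta q : R).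
Hypothesis A_dp : user_level_DP eps delta A.
Hypothesis eps_bnd : 0 <= eps <= 4^-1.
Hypothesis delta_ge0 : 0 <= delta.
Hypothesis N_le : (N <= u * m)%N.
Hypothesis q_ge : N%:R / (u * m)%:R <= q.
Let eta := 4 * (eps * q).
Let zeta := 4 * (delta * q).
Hypothesis eta_bnd : eta <= 2^-1.

Let q0 : 0 <= q.
Proof. by apply: le_trans q_ge; rewrite divr_ge0. Qed.

Let eta_ge0 : 0 <= eta <= 2^-1.
Proof. by case/andP: eps_bnd => e0 _; rewrite eta_bnd andbT !mulr_ge0. Qed.

Let zeta_ge0 : 0 <= zeta.
Proof. by rewrite !mulr_ge0. Qed.

Let P (U : {set 'I_n}) (x : n.-tuple (m.-tuple Z)) : O -> R := subsample A U x.

(** Swapping any subset of the cells of [U :\: U'] with their partners preserves the law of the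
    data. This turns the pair [U], [U'] into a pair of antipodal points of a cube, where
    [cube_indist_whp] holds for every fixed [x]. *)
Lemma bad_pair_le (D : probability Z R) (U U' : {set 'I_n}) (t k s db : R) (lam J : nat) :
  #|U| = u -> #|U'| = u -> (#|U :\: U'|%SET <= J)%N ->
  0 <= t <= 2^-1 -> 0 <= s -> k * eta <= 8^-1 -> 0 < db ->
  32 * ((J * m)%:R * zeta) <= db ->
  expR (- (t * lam%:R)) *
    expR (2 * lam%:R * eta ^+ 2 + 2 * ((2 * lam + 1)%:R * eta) ^+ 2) ^+ (J * m) <= db / 8 ->
  (iid (iid D m) n [set x | ~~ indist (t + 2 * (k * eta)) db (P U x) (P U' x)]
    <= (2 * expR (- (s * k) + s ^+ 2 * (J * m)%:R))%:E)%E.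
Proof.
move=> cU cU' DJ t01 s0 ke db0 Jz lamb.
have [rho [rhoK rhoU rho_id]] := exchange_involution (etrans cU (esym cU')).
have rhoU' i : (rho i \in U) = (i \in U') by rewrite -rhoU rhoK.
pose E := (U :\: U')%SET.
pose sw (a : 'I_n * 'I_m) := (rho a.1, a.2).
have swK : involutive sw by case=> i l; rewrite /sw rhoK.
(* For a cell moved by [sw], [c a] is the member of the pair [a], [sw a] that belongs to a user in
   [E]. Thus both cells of a pair obey the same bit of [v], and [sv v] is an involution. *)
pose c a := if a.1 \in E then a else sw a.
pose as_ := enum (cells m E).
have as_size : size as_ = (#|E| * m)%N by rewrite -cardE card_cells.
pose flag v a := nth false v (index a as_).
pose sv v a := if flag v (c a) then sw a else a.
have fixed a : (a.1 \in U) = (a.1 \in U') -> sw a = a.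
  by case: a => i l /= /rho_id; rewrite /sw /= => ->.
have c_sw a : c (sw a) = c a \/ sw a = a.
  have [e|ne] := eqVneq (a.1 \in U) (a.1 \in U'); first by right; exact: fixed.
  left; rewrite /c /= !inE rhoU rhoU' swK; move: ne.
  by case: (a.1 \in U); case: (a.1 \in U').
have svK v : involutive (sv v).
  move=> a; rewrite /sv; case: (boolP (flag v (c a))) => fl; last by rewrite (negbTE fl).
  by case: (c_sw a) => e; rewrite ?swK !e fl ?swK ?e.
have svU v a : a \in cells m U -> sv v a = if flag v a then sw a else a.
  rewrite inE => aU; rewrite /sv /c inE aU andbT.
  case: (boolP (a.1 \in U')) => //= aU'.
  by rewrite (fixed a) ?aU ?aU' //; case: ifP; case: ifP.
have sv_sw v a : a \in cells m U -> size v = size as_ ->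
    sv v (sw a) = sv (map negb v) a.
  move=> aC sz; rewrite (svU _ _ aC); move: aC; rewrite inE => aU.
  case: (boolP (a.1 \in U')) => aU'.
    have fa : sw a = a by apply: fixed; rewrite aU aU'.
    by rewrite fa /sv fa; case: ifP; case: ifP.
  have aE : a.1 \in E by rewrite inE aU aU'.
  have -> : flag (map negb v) a = ~~ flag v a.
    by rewrite /flag (nth_map false) // sz index_mem mem_enum inE.
  rewrite /sv /c /= !inE rhoU rhoU' aU (negbTE aU') /= swK.
  by case: (flag v a).
pose M := size as_.
pose Q x v := P U (sel (sv v) x).
(* Reading with [U'] means reading the partner cells, and these hold the data that [U] would read
   under the complementary bits. *)
have Qneg x v : size v = M -> P U' (sel (sv v) x) = Q x (map negb v).
  move=> szv; rewrite /P (@subsample_swap _ _ _ _ _ _ _ A sw U U') //; last first.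
    by move=> a; rewrite !inE /= rhoU.
  by apply: subsample_local => a aU; rewrite !item_sel sv_sw.
have Qdp x v w : size v = M -> size w = M -> ham v w = 1%N -> indist eta zeta (Q x v) (Q x w).
  move=> szv szw h1; have [p pv vw] := ham1_nth (etrans szv (esym szw)) h1.
  have a0 : 'I_n * 'I_m by move: pv; rewrite szv /M; case: (as_) => // a.
  apply: (@subsample_indist _ _ _ _ _ _ _ _ _ _ A_dp eps_bnd delta_ge0 _ _ _ (nth a0 as_ p)).
  - by rewrite cU.
  - by rewrite cU.
  move=> b bU bp; rewrite !item_sel !svU // /flag vw //.
  (* A cell outside [as_] has its index past the end, hence different from [p]. *)
  have [bas|bas] := boolP (b \in as_).
    by apply: contraNneq bp => <-; rewrite nth_index.
  by rewrite memNindex // gt_eqF // -[size as_]/M -szv.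
have MJ : (M <= J * m)%N by rewrite /M as_size leq_mul2r DJ orbT.
have cube x : avg M (fun v => (~~ indist (t + 2 * (k * eta)) db (Q x v) (Q x (map negb v)))%:R)
    <= 2 * expR (- (s * k) + s ^+ 2 * (J * m)%:R).
  apply: (@le_trans _ _ (2 * expR (- (s * k) + s ^+ 2 * M%:R))).
    apply: (@cube_indist_whp R O M (Q x) eta zeta _ _ _ eta_ge0 zeta_ge0 t k s db lam) => //.
    - by move=> v o; exact: subsample_ge0.
    - by move=> v; apply: subsample_sum1; rewrite cU.
    - exact: Qdp.
    - by apply: le_trans Jz; rewrite ler_pM2l // ler_wpM2r // ler_nat.
    - apply: le_trans lamb; rewrite ler_pM2l ?expR_gt0 //; apply: ler_weXn2l => //.
      rewrite -expR0 ler_expR; case/andP: eta_ge0 => e0 _.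
      by rewrite addr_ge0 // mulr_ge0 ?sqr_ge0 // mulr_ge0.
  by rewrite ler_pM2l // ler_expR lerD2l ler_wpM2l ?sqr_ge0 // ler_nat.
set B := [set x | _].
have mB : measurable B.
  rewrite (_ : B = ~` [set x | indist (t + 2 * (k * eta)) db (P U x) (P U' x)]).
    by apply: measurableC; apply: measurable_indist => V o; exact: measurable_subsample.
  by apply/seteqP; split => x /= /negP.
have mI : measurable_fun setT (\1_B : _ -> R) by exact: measurable_indic.
have I0 x : 0 <= \1_B x :> R by rewrite indicE.
have BE : iid (iid D m) n B = (\int[iid (iid D m) n]_x (\1_B x)%:E)%E.
  by rewrite integral_indic // setIT.
have svI v : injective (sv v) by exact: inv_inj (svK v).
have int_v v : (\int[iid (iid D m) n]_x (\1_B (sel (sv v) x))%:E = iid (iid D m) n B)%E.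
  by rewrite BE (integral_sel D (svI v) mI I0).
(* Every [v] gives the same probability, so the probability equals the integral of the cube average,
   which [cube] bounds pointwise. *)
rewrite -(@integral_avg _ _ _ (iid (iid D m) n) M (fun v x => \1_B (sel (sv v) x)) _ _ _ int_v).
- apply: (@le_trans _ _ (\int[iid (iid D m) n]_x
      (2 * expR (- (s * k) + s ^+ 2 * (J * m)%:R))%:E)%E).
    apply: ge0_le_integral => //.
    + by move=> x _; rewrite lee_fin; apply: avg_ge0.
    + apply: measurableT_comp => //; apply: measurable_avg => v.
      exact: (measurableT_comp mI (measurable_sel (sv v))).
    + move=> x _; rewrite lee_fin; apply: le_trans (cube x); apply: avg_le => v szv.
      rewrite indicE -Qneg //; case: (boolP (_ \in B)) => //; rewrite inE => Bx.
      by rewrite (_ : ~~ _ = true).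
  by rewrite integral_cst //= [X in (_ * X)%E](probability_setT (iid (iid D m) n)) mule1.
- by move=> v; exact: (measurableT_comp mI (measurable_sel (sv v))).
- by move=> v x.
Qed.

End bad_pairs.

Lemma measure_bigsetU_le (R : realType) (d : measure_display) (X : measurableType d)
    (mu : probability X R) (I : Type) (s : seq I) (B : I -> set X) (b : R) :
  (forall i, measurable (B i)) -> (forall i, (mu (B i) <= b%:E)%E) ->
  (mu (\big[setU/set0]_(i <- s) B i) <= ((size s)%:R * b)%:E)%E.
Proof.
move=> mB Bb; elim: s => [|i s IH]; first by rewrite big_nil measure0 mul0r.
rewrite big_cons /= -natr1 mulrDl mul1r addrC EFinD.
apply: le_trans (leeD (Bb i) IH); apply: measureU2 => //.
exact: bigsetU_measurable.
Qed.

(** Counting the [J] omitted elements keeps the exponent independent of [u]. *)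
Lemma bin_le_exp n u J : n = (u + J)%N -> ('C(n, u) <= n ^ J)%N.
Proof.
move=> ->; rewrite -bin_sub ?leq_addr // addKn.
apply: leq_trans (_ : _ <= (u + J) ^_ J)%N _.
  by rewrite -bin_ffact leq_pmulr // fact_gt0.
move: (u + J)%N => k; elim: J => [|J IH]; first by rewrite ffactn0.
by rewrite ffactnSr expnSr leq_mul // leq_subr.
Qed.

Section user_level_algorithm.
Context (R : realType) (d : measure_display) (Z : measurableType d) (O : finType).
Variables (N m u kappa : nat) (A : rand_alg R Z O N 1) (eps delta q : R).
Hypothesis A_dp : user_level_DP eps delta A.
Hypothesis eps_bnd : 0 <= eps <= 4^-1.
Hypothesis delta_ge0 : 0 <= delta.
Hypothesis N_le : (N <= u * m)%N.
Hypothesis q_ge : N%:R / (u * m)%:R <= q.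
Let eta := 4 * (eps * q).
Let zeta := 4 * (delta * q).
Hypothesis eta_bnd : eta <= 2^-1.
Let J := (2 * kappa + 1)%N.
Let n := (u + J)%N.
Variables (t k s db : R) (lam : nat).
Let eb := t + 2 * (k * eta).
Hypothesis t_bnd : 0 <= t <= 2^-1.
Hypothesis s_ge0 : 0 <= s.
Hypothesis k_ge0 : 0 <= k.
Hypothesis k_bnd : k * eta <= 8^-1.
Hypothesis db_bnd : 0 < db <= 1.
Hypothesis zeta_bnd : 32 * ((J * m)%:R * zeta) <= db.
Hypothesis lam_bnd : expR (- (t * lam%:R)) *
    expR (2 * lam%:R * eta ^+ 2 + 2 * ((2 * lam + 1)%:R * eta) ^+ 2) ^+ (J * m) <= db / 8.
Hypothesis expR_eb : expR eb <= 2.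
Hypothesis kappa_large : 2 * expR (- (eb * (kappa%:R / 2))) <= db.

Let P (U : {set 'I_n}) (x : n.-tuple (m.-tuple Z)) : O -> R := subsample A U x.
Let fail := (n ^ (2 * J))%:R * (2 * expR (- (s * k) + s ^+ 2 * (J * m)%:R)).

Let P_sum1 (U : {set 'I_n}) x : #|U| = u -> \sum_o P U x o = 1.
Proof. by move=> cU; apply: subsample_sum1; rewrite cU. Qed.

Let P_local (U : {set 'I_n}) x y : (forall i, i \in U -> tnth x i = tnth y i) -> P U x = P U y.
Proof.
by move=> xy; apply: subsample_local => -[i l]; rewrite inE /item /= => /xy ->.
Qed.

Let mP U o : measurable_fun setT (fun x => P U x o).
Proof. exact: measurable_subsample. Qed.

Let n_large : (u + (2 * kappa + 1) <= n)%N. Proof. by []. Qed.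

Let eb_ge0 : 0 <= eb.
Proof.
have q0 : 0 <= q by apply: le_trans q_ge; rewrite divr_ge0.
case/andP: eps_bnd => e0 _; case/andP: t_bnd => t0 _.
by apply: addr_ge0 => //; rewrite !mulr_ge0.
Qed.

(** A union bound over at most [n ^ (2 * J)] pairs. Two draws of [u] users among [u + J] differ in
    at most [J] of them, which is the dimension bound needed by [bad_pair_le]. *)
Lemma unstable_le (D : probability Z R) :
  (iid (iid D m) n [set x | ~~ stable u P eb db x finset.set0] <= fail%:E)%E.
Proof.
pose draws : {set {set 'I_n}} := [set U : {set 'I_n} | #|U| == u]%SET.
pose bad (p : {set 'I_n} * {set 'I_n}) : set (n.-tuple (m.-tuple Z)) :=
  if p \in finset.setX draws draws then [set x | ~~ indist eb db (P p.1 x) (P p.2 x)] else set0.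
have mbad p : measurable (bad p).
  rewrite /bad; case: ifP => // _.
  rewrite (_ : [set x | _] = ~` [set x | indist eb db (P p.1 x) (P p.2 x)]).
    by apply: measurableC; exact: measurable_indist.
  by apply/seteqP; split => x /= /negP.
have e0 : 0 <= expR (- (s * k) + s ^+ 2 * (J * m)%:R) by exact: expR_ge0.
have lebad p : (iid (iid D m) n (bad p) <=
    (2 * expR (- (s * k) + s ^+ 2 * (J * m)%:R))%:E)%E.
  rewrite /bad; case: ifP; last by rewrite measure0 lee_fin mulr_ge0.
  case: p => U U'; rewrite !inE /= => /andP[/eqP cU /eqP cU'].
  apply: (@bad_pair_le _ _ _ _ N n m u A eps delta q A_dp eps_bnd delta_ge0 N_le q_ge
    eta_bnd D U U' t k s db lam J) => //.
    apply: (@leq_trans #|~: U'|%SET).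
      by apply: subset_leq_card; apply/fintype.subsetP => i; rewrite !inE => /andP[].
    by have := cardsC U'; rewrite card_ord cU' => /addnI ->.
  by case/andP: db_bnd.
have sub : [set x | ~~ stable u P eb db x finset.set0] `<=`
    \big[setU/set0]_(p <- enum (finset.setX draws draws)) bad p.
  move=> x /= /forallPn[U /forallPn[U']]; rewrite negb_imply => /andP[].
  move=> /and4P[cU cU' _ _] nd; rewrite -bigcup_seq; exists (U, U') => /=.
    by rewrite mem_enum !inE cU cU'.
  by rewrite /bad !inE /= cU cU'.
apply: (le_trans (le_measure _ _ _ sub)).
- rewrite inE (_ : [set x | _] = ~` [set x | stable u P eb db x finset.set0]).
    by apply: measurableC; exact: measurable_stable.
  by apply/seteqP; split => x /= /negP.
- by rewrite inE; exact: bigsetU_measurable.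
apply: (le_trans (measure_bigsetU_le _ mbad lebad)).
rewrite lee_fin /fail ler_wpM2r ?mulr_ge0 // ler_nat -cardE cardsX card_draws card_ord.
by rewrite mul2n -addnn expnD leq_mul // bin_le_exp.
Qed.

Lemma witness_setT : #|witness u kappa [set: {set 'I_n}]%SET| = u.
Proof.
have [|S _ cS] := @ex_superset_card _ (finset.set0 : {set 'I_n}) kappa.
  by rewrite cards0 card_ord /n /J; clear; lia.
have [|U US cU] := @ex_subset_card _ (~: S)%SET u.
  by have := cardsC S; rewrite card_ord cS /n /J; clear; lia.
rewrite /witness; case: pickP => /= [V /andP[/eqP //]|/(_ U)].
by rewrite cU eqxx /= => /negbT/existsPn/(_ S); rewrite inE cS eqxx US.
Qed.

(** Once the empty set is stable every set is, so the signature is full and the witness is a fixed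
    set that does not depend on the data. Choosing the witness thus introduces no bias. *)
Lemma stable_set0_release x o : stable u P eb db x finset.set0 ->
  stable_release u kappa P eb db x o = P (witness u kappa [set: {set 'I_n}]%SET) x o.
Proof.
move=> st; have sgT : signature u P eb db x = [set: {set 'I_n}]%SET.
  apply/setP => S; rewrite !inE; apply: stable_sub st; exact: finset.sub0set.
by rewrite /stable_release sgT stab_radius_setT release0 subrr mul0r addr0 mul1r.
Qed.

(** Each injective selection from i.i.d. data is itself i.i.d., so for a fixed [U] subsampling loses
    no utility. *)
Lemma integral_subsample (D : probability Z R) (U : {set 'I_n}) (T : {set O}) : #|U| = u ->
  (\int[iid (iid D m) n]_x (\sum_(o in T) P U x o)%:E =
   \int[iid (iid D 1) N]_y (prob_in A y T)%:E)%E.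
Proof.
move=> cU.
have mA : measurable_fun setT (fun y => prob_in A y T).
  rewrite (_ : (fun y => _) = (fun y => \sum_o if o \in T then A y o else 0)).
    by apply: measurable_sum => o; case: (o \in T) => //; exact: prob_measurable.
  by apply/funext => y; rewrite /prob_in big_mkcond.
have A0 y : 0 <= prob_in A y T by apply: sumr_ge0 => o _; exact: prob_ge0.
set IA := (RHS).
have cI : (0 < #|injs N (cells m U)|)%N by rewrite card_injs_gt0 // card_cells cU.
under eq_integral => x _ do rewrite sum_subsample EFinM -sumEFin big_mkcond /=.
have mf f : measurable_fun setT (fun x : n.-tuple (m.-tuple Z) =>
    if f \in injs N (cells m U) then (prob_in A (sel (pick_items f) x) T)%:E else 0%E).
  case: (f \in injs N (cells m U)) => //; apply: measurableT_comp => //.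
  exact: (measurableT_comp mA (measurable_sel (pick_items f))).
have f0 f (x : n.-tuple (m.-tuple Z)) :
    (0 <= if f \in injs N (cells m U) then (prob_in A (sel (pick_items f) x) T)%:E else 0)%E.
  by case: ifP => // _; rewrite lee_fin.
have mS := emeasurable_sum (index_enum _) mf.
rewrite ge0_integralZl //; last by move=> x _; apply: sume_ge0 => f _; exact: f0.
rewrite ge0_integral_sum //.
rewrite (eq_bigr (fun f => if f \in injs N (cells m U) then IA else 0%E)) => [|f _]; last first.
  case: (boolP (f \in injs N (cells m U))) => [/injsP[_ finj]|_]; last by rewrite integral0.
  apply: (integral_sel D _ mA A0) => -[i a] [j b] /finj /= ->.
  by rewrite (ord1 a) (ord1 b).
rewrite -big_mkcond /= sumr_const.
rewrite [X in (_ * X)%E](_ : _ = (#|injs N (cells m U)|%:R%:E * IA)%E); last by rewrite mule_natl.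
by rewrite muleA -EFinM mulVf ?mul1e // pnatr_eq0 -lt0n.
Qed.

Lemma user_level_achievable (T : task R Z O) (gamma : R) :
  useful T gamma A -> achievable T m (3 * eb) (8 * db) (gamma - fail) n.
Proof.
move=> A_useful; case/andP: db_bnd => db0 db1.
(* The uniform fallback needs a nonempty output set; given any input, the masses of [P] sum to 1 and
   provide it. *)
have O_gt0 (x : n.-tuple (m.-tuple Z)) : (0 < #|O|)%N.
  rewrite lt0n; apply/eqP => /eqP; rewrite eq_sym => O0.
  have := P_sum1 x witness_setT; rewrite big1 => [/eqP|o]; first by rewrite eq_sym oner_eq0.
  by have := fintype0 o; rewrite (eqP O0) => /(_ erefl).
have P_ge0 (U : {set 'I_n}) x o : 0 <= P U x o by exact: subsample_ge0.
have r0 x o : 0 <= stable_release u kappa P eb db x o by exact: stable_release_ge0.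
have r1 x : \sum_o stable_release u kappa P eb db x o = 1.
  by apply: stable_release_sum1 (O_gt0 x).
have rm o : measurable_fun setT (fun x => stable_release u kappa P eb db x o).
  exact: measurable_stable_release.
pose mech : rand_alg R Z O n m := RandAlg r0 r1 rm.
exists mech; split.
  move=> x x' [i xx'] S; rewrite /prob_in.
  by apply: stable_release_private (O_gt0 x) xx'.
move=> D vD; set S := correct T D; set U := witness u kappa [set: {set 'I_n}]%SET.
pose G := [set x : n.-tuple (m.-tuple Z) | ~~ stable u P eb db x finset.set0].
have mG : measurable G.
  rewrite (_ : G = ~` [set x | stable u P eb db x finset.set0]).
    by apply: measurableC; exact: measurable_stable.
  by apply/seteqP; split => x /= /negP.
have mech0 x : 0 <= prob_in mech x S by apply: sumr_ge0 => o _; exact: prob_ge0.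
have mmech : measurable_fun setT (fun x => (prob_in mech x S)%:E).
  apply: measurableT_comp => //.
  rewrite (_ : (fun x => _) = (fun x => \sum_o if o \in S then mech x o else 0)).
    by apply: measurable_sum => o; case: (o \in S) => //; exact: prob_measurable.
  by apply/funext => x; rewrite /prob_in big_mkcond.
have mI : measurable_fun setT (fun x => (\1_G x)%:E : \bar R).
  by apply: measurableT_comp => //; exact: measurable_indic.
(* Off the unstable event the mechanism coincides with the fixed subsample; on it the indicator
   alone dominates. *)
have point x : \sum_(o in S) P U x o <= prob_in mech x S + \1_G x.
  rewrite indicE; have [st|nst] := boolP (stable u P eb db x finset.set0).
    rewrite memNset /= ?addr0; last by rewrite /G /= st.
    rewrite le_eqVlt; apply/orP; left; apply/eqP/eq_bigr => o _.
    by rewrite -stable_set0_release.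
  rewrite mem_set //; apply: (@le_trans _ _ 1); last by rewrite lerDr.
  by rewrite -(P_sum1 x witness_setT) [leRHS](bigID (mem S)) /= lerDl sumr_ge0.
have := A_useful D vD; rewrite -(integral_subsample D S witness_setT) => gle.
rewrite EFinB leeBlDr //; apply: (le_trans gle).
apply: (@le_trans _ _ (\int[iid (iid D m) n]_x ((prob_in mech x S)%:E + (\1_G x)%:E))%E).
  apply: ge0_le_integral => //.
  - by move=> x _; rewrite lee_fin sumr_ge0.
  - apply: measurableT_comp => //.
    rewrite (_ : (fun x => _) = (fun x => \sum_o if o \in S then P U x o else 0)).
      by apply: measurable_sum => o; case: (o \in S).
    by apply/funext => x; rewrite big_mkcond.
  - exact: emeasurable_funD.
  - by move=> x _; rewrite -EFinD lee_fin; exact: point.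
rewrite ge0_integralD //; try by move=> x _; rewrite lee_fin.
by rewrite leeD2l // integral_indic // setIT; exact: unstable_le.
Qed.

End user_level_algorithm.

(** * Choice of the parameters *)

Section parameters.
Context (R : realType).
Implicit Types (eps delta x w B : R).

Lemma ex_nat_near x : 0 <= x -> exists k : nat, x <= k%:R <= x + 1.
Proof.
move=> x0; exists (Num.Def.trunc x).+1; have /andP[lo /ltW hi] := truncn_itv x0.
by rewrite hi /= -natr1 lerD2r.
Qed.

Lemma expRN_sqr_small (l : R) : 64 <= l -> expR (- (2 * l)) <= expR (- l) / 64.
Proof.
move=> l64; have -> : - (2 * l) = - l + - l by ring.
rewrite expRD ler_pM2l ?expR_gt0 // expRN lef_pV2 ?posrE ?expR_gt0 //.
by apply: le_trans (expR_ge1Dx _); lra.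
Qed.

(** The exponent reaches [2 * l]: one [l] gives the privacy error [expR (- l)], the other absorbs
    the constants. *)
Lemma kappa_choice (eps l x : R) (kap : nat) : 64 <= l -> 0 < eps -> l = eps * x ->
  12 * x <= kap%:R -> 2 * expR (- (eps / 3 * (kap%:R / 2))) <= expR (- l) / 8.
Proof.
move=> l64 e0 lE kx.
have h : expR (- (eps / 3 * (kap%:R / 2))) <= expR (- (2 * l)).
  by rewrite ler_expR lerN2 lE; have := ler_wpM2l (ltW e0) kx; lra.
have := expRN_sqr_small l64; have := expR_ge0 (- l); lra.
Qed.

(* Anything above [164 * 27 * 96^2] would do, see [fail_choice]. *)
Definition slack : R := 100 * (100 * (100 * 100)).

Section choices.
Variables (eps l x w L : R) (m J lam : nat).
Hypothesis l_ge : 64 <= l.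
Hypothesis eps_bnd : 0 < eps <= 1.
Hypothesis lE : l = eps * x.
Hypothesis x_ge : 64 <= x.
Hypothesis w_gt0 : 0 < w.
Hypothesis w_small : m%:R * w ^+ 2 * x ^+ 2 <= eps ^+ 2.
Hypothesis L_ge : slack <= L.
Hypothesis J_le : J%:R <= 27 * x.
Let eta := 4 * (w * L^-1).

Let L_gt0 : 0 < L. Proof. by apply: lt_le_trans L_ge; rewrite !mulr_gt0. Qed.

(** The first factor has exponent [- (eps / 6 * lam)]. By [w_small] the growth over [J * m]
    coordinates, quadratic in [lam * eta], gives back at most half of it, and [lam >= 24 * x] leaves
    at least [2 * l]. *)
Lemma lambda_choice : 24 * x <= lam%:R <= 25 * x ->
  expR (- (eps / 6 * lam%:R)) *
    expR (2 * lam%:R * eta ^+ 2 + 2 * ((2 * lam + 1)%:R * eta) ^+ 2) ^+ (J * m)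
  <= expR (- l) / 8 / 8.
Proof.
case/andP: eps_bnd => e0 e1 /andP[la lb].
have x64 := x_ge; have lE' := lE; have L0 := L_gt0; have Lge := L_ge.
have x0 : 0 <= x by lra.
have lam1 : 1 <= lam%:R :> R by lra.
rewrite -expRM_natr -expRD.
apply: (@le_trans _ _ (expR (- (2 * l)))); last first.
  by apply: (le_trans (expRN_sqr_small l_ge)); have := expR_ge0 (- l); lra.
rewrite ler_expR.
set y := eta ^+ 2; have y0 : 0 <= y by exact: sqr_ge0.
have -> : 2 * lam%:R * y + 2 * ((2 * lam + 1)%:R * eta) ^+ 2 =
    (2 * lam%:R + 2 * (2 * lam%:R + 1) ^+ 2) * y.
  by rewrite exprMn -/y natrD natrM; ring.
have G : (2 * lam%:R + 2 * (2 * lam%:R + 1) ^+ 2) * y <= 20 * lam%:R * lam%:R * y.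
  apply: ler_wpM2r => //.
  have : lam%:R <= lam%:R * lam%:R :> R by rewrite ler_peMl // (le_trans ler01).
  lra.
have ymx : m%:R * y * (x * x) <= 16 / slack * eps.
  have -> : m%:R * y * (x * x) = 16 * (m%:R * w ^+ 2 * x ^+ 2) / (L * L).
    by rewrite /y /eta; field; rewrite gt_eqF.
  apply: (@le_trans _ _ (16 * eps / slack)); last by rewrite -!mulrA [eps * _]mulrC.
  rewrite ler_pdivrMr ?mulr_gt0 //.
  have c0 : 0 < slack by rewrite !mulr_gt0.
  have e2 : eps ^+ 2 <= eps by rewrite expr2 ler_piMl // ltW.
  have L1 : slack <= L * L.
    apply: (le_trans Lge); rewrite ler_peMl ?(ltW L0) //.
    by apply: le_trans Lge; rewrite /slack; lra.
  have h : 16 * eps / slack * slack <= 16 * eps / slack * (L * L).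
    by rewrite ler_wpM2l // divr_ge0 ?mulr_ge0 // ltW.
  rewrite divfK ?gt_eqF // in h; apply: le_trans h; have := w_small; lra.
have Jm : (J * m)%:R * (20 * lam%:R * y) <= eps / 12.
  apply: (@le_trans _ _ (27 * x * m%:R * (20 * (25 * x) * y))).
    have a : J%:R * m%:R <= 27 * x * m%:R by rewrite ler_wpM2r // J_le.
    have b : 20 * lam%:R * y <= 20 * (25 * x) * y by rewrite ler_wpM2r // ler_pM2l.
    by rewrite natrM; apply: ler_pM a b; rewrite mulr_ge0 // mulr_ge0.
  have -> : 27 * x * m%:R * (20 * (25 * x) * y) = 27 * (20 * 25) * (m%:R * y * (x * x)) by ring.
  have : 27 * (20 * 25) * (m%:R * y * (x * x)) <= 27 * (20 * 25) * (16 / slack * eps).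
    by rewrite ler_pM2l.
  rewrite /slack; lra.
have JG : (2 * lam%:R + 2 * (2 * lam%:R + 1) ^+ 2) * y * (J * m)%:R <= eps / 12 * lam%:R.
  apply: (le_trans (ler_wpM2r (ler0n _ _) G)).
  have -> : 20 * lam%:R * lam%:R * y * (J * m)%:R = (J * m)%:R * (20 * lam%:R * y) * lam%:R by ring.
  by rewrite ler_wpM2r.
have := ler_wpM2l (ltW e0) la; lra.
Qed.

(** With at most [J * m] cells and [J <= 27 * x], the normalization of [d'] brings the total error
    to a constant times [expR (- l) / L], and [L] absorbs the constant. *)
Lemma zeta_choice (d' : R) : d' * m%:R * x = expR (- l) -> 0 <= d' ->
  32 * ((J * m)%:R * (4 * (d' * L^-1))) <= expR (- l) / 8.
Proof.
move=> dE d0; rewrite -dE; have L0 := L_gt0; have Lge := L_ge; have x64 := x_ge.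
have x0 : 0 <= x by lra.
have -> : 32 * ((J * m)%:R * (4 * (d' / L))) = 32 * 4 * (J%:R * (d' * m%:R)) / L.
  by rewrite natrM; field; rewrite gt_eqF.
rewrite ler_pdivrMr //.
have dm : 0 <= d' * m%:R by rewrite mulr_ge0.
have h1 : J%:R * (d' * m%:R) <= 27 * x * (d' * m%:R) by rewrite ler_wpM2r // J_le.
have h2 : slack * (d' * m%:R * x) <= L * (d' * m%:R * x) by rewrite ler_wpM2r // mulr_ge0.
move: h2; rewrite /slack => h2.
have h3 : 0 <= d' * m%:R * x by rewrite mulr_ge0.
lra.
Qed.

(** The concentration exponent is at least of order [x * L * L], because the sampling rate [L^-1]
    makes [eta] small, whereas the union bound costs only [2 * J * ln n], of order [x * L]. A large
    [L] therefore wins. *)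
Lemma fail_choice (B : R) (n : nat) : (0 < m)%N -> (0 < J)%N ->
  x <= B -> 1 <= ln B <= L -> (0 < n)%N -> n%:R <= 2 * L * B ->
  forall k s, k = eps / (12 * eta) -> s = k / (2 * (J * m)%:R) ->
  (n ^ (2 * J))%:R * (2 * expR (- (s * k) + s ^+ 2 * (J * m)%:R)) <= B^-1.
Proof.
move=> m0 J0 xB /andP[B1 BL] n0 nB k s kdef sdef.
case/andP: eps_bnd => e0 e1; have x64 := x_ge; have L0 := L_gt0; have Lge := L_ge.
have x0 : 0 < x by lra.
have B0 : 0 < B by lra.
have mR : 0 < m%:R :> R by rewrite ltr0n.
have JR : 0 < J%:R :> R by rewrite ltr0n.
have nR : 0 < n%:R :> R by rewrite ltr0n.
have w0 := w_gt0.
(* The given [s] minimizes this quadratic. *)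
have -> : - (s * k) + s ^+ 2 * (J * m)%:R = - (k ^+ 2 / (4 * (J%:R * m%:R))).
  by rewrite sdef natrM; field; rewrite !gt_eqF.
have kE : x * L * L / (96 * 96 * 27) <= k ^+ 2 / (4 * (J%:R * m%:R)).
  rewrite ler_pdivlMr; last by rewrite !mulr_gt0.
  apply: (@le_trans _ _ (x * L * L / (96 * 96 * 27) * (4 * (27 * x * m%:R)))).
    have c1 : 0 <= x * L * L / (96 * 96 * 27) by rewrite divr_ge0 // !mulr_ge0 // ltW.
    by apply: ler_wpM2l => //; rewrite ler_pM2l // ler_pM2r // J_le.
  have -> : k ^+ 2 = eps ^+ 2 * (L * L) / (48 * 48 * w ^+ 2).
    by rewrite kdef /eta; field; rewrite !gt_eqF.
  rewrite ler_pdivlMr; last by rewrite !mulr_gt0 // exprn_gt0.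
  have -> : x * L * L / (96 * 96 * 27) * (4 * (27 * x * m%:R)) * (48 * 48 * w ^+ 2) =
     (m%:R * w ^+ 2 * x ^+ 2) * (L * L) by field.
  by rewrite ler_wpM2r // mulr_ge0 // ltW.
(* Here 2 comes from [ln (2 * L) <= 2 * L] and 1 from [ln B <= L]. The union bound then costs 162
   times [x * L], and the factor 2 with [B^-1] another 2, whence 164 below. *)
have lnn : ln n%:R <= 3 * L.
  apply: (@le_trans _ _ (ln (2 * L * B))).
    by rewrite ler_ln ?posrE // !mulr_gt0.
  rewrite lnM ?posrE ?mulr_gt0 //.
  have : ln (2 * L) <= 2 * L by apply/ltW/ln_sublinear; rewrite mulr_gt0.
  lra.
have nE : (n ^ (2 * J))%:R = expR (2 * J%:R * ln n%:R) :> R.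
  by rewrite natrX -natrM expRM_natl lnK ?posrE.
have two : 2 <= expR 1 :> R by apply: le_trans (expR_ge1Dx _); lra.
have BE : B^-1 = expR (- ln B) by rewrite expRN lnK ?posrE.
rewrite nE BE; apply: (@le_trans _ _ (expR (2 * J%:R * ln n%:R) *
    (expR 1 * expR (- (k ^+ 2 / (4 * (J%:R * m%:R))))))).
  by rewrite ler_pM2l ?expR_gt0 // ler_pM2r ?expR_gt0.
rewrite -!expRD ler_expR.
have h1 : 2 * J%:R * ln n%:R <= 2 * (27 * x) * (3 * L).
  have a : 2 * J%:R <= 2 * (27 * x) by rewrite ler_pM2l // J_le.
  have n1 : 0 <= ln n%:R :> R by apply: ln_ge0; rewrite ler1n.
  by apply: ler_pM a lnn; rewrite ?mulr_ge0.
have h2 : 1 + ln B <= 2 * (x * L).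
  have : 64 * L <= x * L by rewrite ler_pM2r.
  lra.
have h3 : 164 * (x * L) <= x * L * L / (96 * 96 * 27).
  rewrite ler_pdivlMr //.
  have xL : 0 <= x * L by rewrite mulr_ge0 // ltW.
  have := ler_wpM2l xL Lge; rewrite /slack; lra.
lra.
Qed.

End choices.
End parameters.

(** * From item-level to user-level sample complexity *)

Section final_bound.
Context (R : realType).

(** The square root in [item_eps] cancels the factor [m]: the left side of the last bound is
    [eps ^+ 2] divided by the logarithm of [m / delta], which is at least 1. *)
Lemma item_eps_props (eps delta l : R) (m : nat) :
  0 < eps <= 1 -> 64 <= l -> delta = expR (- l) -> (0 < m)%N ->
  [/\ 0 < item_eps eps delta m, item_eps eps delta m <= 8^-1 &
      m%:R * item_eps eps delta m ^+ 2 * (l / eps) ^+ 2 <= eps ^+ 2].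
Proof.
move=> /andP[e0 e1] l64 dE m0.
have m1 : 1 <= m%:R :> R by rewrite ler1n.
have mR : 0 < m%:R :> R by lra.
have lE : ln delta^-1 = l by rewrite dE -expRN opprK expRK.
rewrite /item_eps lE; set Lm := ln _.
have Lml : l <= Lm.
  rewrite /Lm dE -expRN opprK lnM ?posrE ?expR_gt0 // expRK lerDr; exact: ln_ge0.
have mL : 1 <= m%:R * Lm by rewrite mulr_ege1 //; lra.
set S := Num.sqrt _.
have S1 : 1 <= S by rewrite -sqrtr1 ler_wsqrtr.
have S2 : S ^+ 2 = m%:R * Lm by rewrite sqr_sqrtr // (le_trans ler01).
have lS : 64 <= l * S by rewrite -[64]mulr1 ler_pM.
have lS0 : 0 < l * S by lra.
have S0 : S != 0 by rewrite gt_eqF //; lra.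
have l0 : l != 0 by rewrite gt_eqF //; lra.
split; first by rewrite divr_gt0 // exprn_gt0.
  rewrite ler_pdivrMr //.
  have : eps ^+ 2 <= 1 by rewrite expr_le1 // ltW.
  lra.
have -> : m%:R * (eps ^+ 2 / (l * S)) ^+ 2 * (l / eps) ^+ 2 = eps ^+ 2 * m%:R / S ^+ 2.
  by field; rewrite S0 l0 gt_eqF.
rewrite S2 -mulrA ler_piMr ?sqr_ge0 // ler_pdivrMr ?mul1r; last lra.
by rewrite ler_peMr ?ltW //; lra.
Qed.

Lemma achievable_le (d : measure_display) (Z : measurableType d) (O : finType)
    (T : task R Z O) (m n : nat) (eps delta gamma gamma' : R) : gamma' <= gamma ->
  achievable T m eps delta gamma n -> achievable T m eps delta gamma' n.
Proof.
move=> gg [A [dp us]]; exists A; split => // D vD.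
by apply: le_trans (us D vD); rewrite lee_fin.
Qed.

Lemma user_level_from_item_level (d : measure_display) (Z : measurableType d) (O : finType)
    (T : task R Z O) (gamma eps delta B : R) (m N : nat) :
  0 < eps <= 1 -> 0 < delta <= expR (- (64 + expR 1)) -> (0 < m)%N ->
  B = ln delta^-1 / eps + m%:R^-1 * N%:R ->
  achievable T 1 (item_eps eps delta m) (item_delta_scale eps delta m) gamma N ->
  [/\ 0 < B, 1 <= ln B & exists2 n : nat, achievable T m eps delta (gamma - B^-1) n &
    n%:R <= 4 * slack R * B * ln B].
Proof.
move=> eps_bnd /andP[d0 dle] m0 BE [A [A_dp A_us]].
case/andP: (eps_bnd) => e0 e1.
set l := ln delta^-1 in BE.
have dE : delta = expR (- l) by rewrite /l expRN lnK ?posrE ?invr_gt0 // invrK.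
have e1pos : 0 < expR 1 :> R by exact: expR_gt0.
have l_ge : 64 + expR 1 <= l by move: dle; rewrite dE ler_expR lerN2.
have l64 : 64 <= l by lra.
pose x := l / eps; have lE : l = eps * x by rewrite /x mulrC divfK // gt_eqF.
have lx : l <= x by rewrite /x ler_pdivlMr // ler_piMr //; lra.
have x64 : 64 <= x by lra.
have m1 : 1 <= m%:R :> R by rewrite ler1n.
have mR : 0 < m%:R :> R by lra.
have NR : 0 <= m%:R^-1 * N%:R :> R by rewrite mulr_ge0 // invr_ge0.
have xB : x <= B by rewrite BE -/x lerDl.
have B0 : 0 < B by lra.
(* The summand [expR 1] in the bound on [delta] serves this step, giving [B >= expR 1] without a
   numerical estimate of [expR 1]. *)
have lnB : 1 <= ln B.
  by rewrite -[leLHS]expRK ler_ln ?posrE ?expR_gt0 //; lra.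
split => //.
have [w0 w4 wx] := item_eps_props eps_bnd l64 dE m0.
set w := item_eps eps delta m in A_dp w0 w4 wx; rewrite -/x in wx.
set d' := item_delta_scale eps delta m in A_dp.
have d'E : d' * m%:R * x = expR (- l).
  rewrite -dE /d' /item_delta_scale -/l /x; field.
  by rewrite !gt_eqF //; lra.
have d'0 : 0 <= d'.
  by rewrite /d' /item_delta_scale -/l mulr_ge0 ?divr_ge0 ?mulr_ge0 //; lra.
clearbody w d'.
have c0 : 1 <= slack R by rewrite /slack; lra.
have [L /andP[L_ge L_le]] : exists L : nat, slack R * ln B <= L%:R <= slack R * ln B + 1.
  by apply: ex_nat_near; rewrite mulr_ge0 //; lra.
have [kap /andP[kap_ge kap_le]] : exists k : nat, 12 * x <= k%:R <= 12 * x + 1.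
  by apply: ex_nat_near; lra.
have [lam /andP[lam_ge lam_le]] : exists k : nat, 24 * x <= k%:R <= 24 * x + 1.
  by apply: ex_nat_near; lra.
have Lc : slack R <= L%:R by apply: le_trans L_ge; rewrite ler_peMr //; lra.
have LB : ln B <= L%:R by apply: le_trans L_ge; rewrite ler_peMl //; lra.
have L0 : 0 < L%:R :> R by lra.
pose J := (2 * kap + 1)%N.
have J_le : J%:R <= 27 * x by rewrite /J natrD natrM; lra.
(* [r] users hold enough examples for one run of [A]. Taking [L] times as many lowers the sampling
   rate to [L^-1], and the [J] extra users leave room for the stable sets. *)
pose r := (N %/ m).+1; pose u := (L * r)%N; pose n := (u + J)%N.
have rm : (N <= r * m)%N by rewrite ltnW // ltn_ceil.
have r_le : r%:R <= B.
  rewrite /r -natr1 BE -/x addrC.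
  apply: lerD; first by lra.
  by rewrite mulrC ler_pdivlMr // -natrM ler_nat leq_divM.
have N_le : (N <= u * m)%N.
  apply: (leq_trans rm); rewrite leq_mul2r /u leq_pmull ?orbT //.
  by rewrite -(ltr0n R).
have q_ge : N%:R / (u * m)%:R <= L%:R^-1 :> R.
  have um : (0 < u * m)%N by rewrite !muln_gt0 m0 -(ltr0n R) L0.
  rewrite ler_pdivrMr ?ltr0n // [leRHS]mulrC ler_pdivlMr //.
  by rewrite -natrM ler_nat /u mulnC -mulnA leq_mul2l rm orbT.
pose eta := 4 * (w * L%:R^-1).
have eta0 : 0 < eta by rewrite /eta !mulr_gt0 // invr_gt0.
have wL : w * L%:R^-1 <= w.
  rewrite ler_piMr ?(ltW w0) // invf_le1 //; lra.
pose k := eps / (12 * eta).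
have ke : k * eta = eps / 12 by rewrite /k; field; rewrite gt_eqF.
have k0 : 0 <= k by rewrite /k divr_ge0 ?mulr_ge0 // ltW.
pose s := k / (2 * (J * m)%:R).
have s0 : 0 <= s by rewrite /s divr_ge0.
(* The cube expectation and the two group-privacy legs each take [eps / 6]; [user_level_achievable]
   triples the sum and multiplies the error [delta / 8] by 8. *)
have eb : eps / 6 + 2 * (k * eta) = eps / 3 by rewrite ke; lra.
have dsm : delta <= 1 by rewrite dE -[leRHS]expR0 ler_expR; lra.
have nB : n%:R <= 2 * L%:R * B.
  rewrite /n /u natrD natrM.
  have : L%:R * r%:R <= L%:R * B by rewrite ler_pM2l.
  have : 27 * B <= L%:R * B by rewrite ler_pM2r //; move: Lc; rewrite /slack; lra.
  lra.
exists n; last first.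
  apply: (le_trans nB).
  have : L%:R * B <= 2 * (slack R * ln B) * B.
    rewrite ler_pM2r //; have : 1 <= slack R * ln B by rewrite mulr_ege1.
    lra.
  lra.
apply: (@achievable_le _ _ _ _ _ _ _ _ (gamma - (n ^ (2 * J))%:R *
    (2 * expR (- (s * k) + s ^+ 2 * (J * m)%:R)))).
  rewrite lerD2l lerN2.
  apply: (@fail_choice R eps x w L%:R m J _ x64 w0 wx Lc J_le B n) => //.
  - by rewrite /J addn1.
  - by rewrite lnB.
  - by rewrite /n /J addn1 addnS.
have -> : eps = 3 * (eps / 6 + 2 * (k * eta)) by rewrite eb; lra.
have -> : delta = 8 * (delta / 8) by lra.
have h := @user_level_achievable R d Z O N m u kap A w d' L%:R^-1 A_dp _ d'0 N_le q_ge
  _ (eps / 6) k s (delta / 8) lam _ s0 k0 _ _ _ _ _ _ T gamma A_us.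
apply: h.
- by rewrite ltW //=; lra.
- by lra.
- by apply/andP; split; lra.
- by rewrite ke; lra.
- by apply/andP; split; lra.
- by rewrite dE; apply: (@zeta_choice R l x L%:R m J).
- by rewrite dE; apply: (@lambda_choice R eps l x w L%:R m J) => //; rewrite lam_ge /=; lra.
- by rewrite eb; apply: (le_trans (expR_le1D2 _)); lra.
- by rewrite eb dE; apply: kappa_choice lE kap_ge.
Qed.

End final_bound.

Lemma cvg_fine_inv (R : realType) : (fine u)^-1 @[u --> +oo%E] --> (0 : R).
Proof.
have FF := ereal_nbhs_filter (+oo%E : \bar R).
apply/(@cvgrPdist_le _ _ _ _ FF) => e e0.
(* A neighbourhood of [+oo] contains [+oo] itself, where [fine] is 0 and so is its inverse. *)
exists e^-1; split => [|[r||] //=]; first exact: num_real.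
  rewrite lte_fin sub0r normrN => er; have r0 : 0 < r by apply: lt_trans er; rewrite invr_gt0.
  by rewrite ger0_norm ?invr_ge0 ?(ltW r0) // -[leRHS]invrK lef_pV2 ?posrE ?invr_gt0 // ltW.
by rewrite invr0 subr0 normr0 ltW.
Qed.

Theorem theorem3p1 (R : realType) :
  exists (eps0 delta0 c1 c2 C : R) (k : nat) (loss : \bar R -> R),
    [/\ 0 < eps0, 0 < delta0, 0 < c1, 0 < c2 & 0 < C] /\
    loss u @[u --> +oo%E] --> (0 : R) /\
    forall (d : measure_display) (Z : measurableType d) (O : finType)
      (T : task R Z O) (gamma : R), 0 < gamma ->
    forall (eps delta : R), 0 < eps <= eps0 -> 0 < delta <= delta0 ->
    forall m : nat, (0 < m)%N ->
    exists eps' delta' : R,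
      [/\ eps' = item_eps eps delta m,
          c1 * item_delta_scale eps delta m <= delta'
            <= c2 * item_delta_scale eps delta m &
          let B := user_scale T m eps delta eps' delta' gamma in
          (sample_complexity T m eps delta (gamma - loss B)
             <= polylog_bound C k B)%E].
Proof.
have c0 : 0 < slack R by rewrite !mulr_gt0.
(* The loss is the inverse of the argument of the soft O, a single logarithm suffices, and [delta']
   equals its scale exactly. *)
exists 1, (expR (- (64 + expR 1))), 1, 1, (4 * slack R), 1%N, (fun u => (fine u)^-1).
split; first by rewrite !ltr01 expR_gt0 mulr_gt0.
split; first exact: cvg_fine_inv.
move=> d Z O T gamma _ eps delta eps_bnd delta_bnd m m0.
exists (item_eps eps delta m), (item_delta_scale eps delta m).
split=> //; first by rewrite mul1r lexx.
have mR : 0 < m%:R :> R by rewrite ltr0n.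
have expe1 (y : \bar R) : (y ^+ 1 = y)%E by [].
pose ach n := `[< achievable T 1 (item_eps eps delta m) (item_delta_scale eps delta m) gamma n >].
(* Without any item-level algorithm the right-hand side is [+oo]. Otherwise the infimum is attained
   at the least achievable [N]. *)
have [exN|noN] := pselect (exists N, ach N); last first.
  rewrite /user_scale /polylog_bound.
  have -> : sample_complexity T 1 (item_eps eps delta m) (item_delta_scale eps delta m) gamma = +oo%E.
    rewrite /sample_complexity (_ : [set _ | _ in _] = set0) ?ereal_inf0 //.
    apply/seteqP; split => // y [N aN _]; exfalso; apply: noN; exists N; exact/asboolP.
  rewrite gt0_muley ?lte_fin ?invr_gt0 // addey // expe1 gt0_muley ?lte_fin ?mulr_gt0 //.
    by rewrite leey.
  by rewrite gt0_muley ?lte_fin ?mulr_gt0 // ltry.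
case: (ex_minnP exN) => N /asboolP aN Nmin.
have scE : sample_complexity T 1 (item_eps eps delta m) (item_delta_scale eps delta m) gamma
    = N%:R%:E.
  apply/le_anti/andP; split; first by apply: ereal_inf_lbound; exists N.
  apply/ereal_infP => y [M aM <-]; rewrite lee_fin ler_nat; apply: Nmin; exact/asboolP.
rewrite /user_scale scE -EFinM -EFinD.
have [B0 lnB [n an nle]] := user_level_from_item_level eps_bnd delta_bnd m0 erefl aN.
rewrite /polylog_bound lne_EFin // expe1 -!EFinM.
apply: (@le_trans _ _ n%:R%:E); last by rewrite lee_fin.
by apply: ereal_inf_lbound; exists n.
Qed.
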